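(* Consider the system $\dot x=F(t,x,H(t)x)$, $(t,x)\in\mathbb R_{\ge0}\times\mathbb R^n$, with output $y=H(t)x\in\mathbb R^k$, where $H:\mathbb R_{\ge0}\to\mathbb R^{k\times n}$ is $C^0$ and $F:\mathbb R_{\ge0}\times\mathbb R^n\times\mathbb R^k\to\mathbb R^n$ is $C^0$ and locally Lipschitz in $(x,y)\in\mathbb R^n\times\mathbb R^k$. Let $M\subset\mathbb R^n$ be nonempty with $0\in\mathrm{cl}\,M$ and assume the system is $M$-forward complete, with bound $\beta\in NNN$. Assume the initial state $x_0\in M$ satisfies $|x_0|\le R$ for some known constant $R>0$. Assume that there exist an integer $\ell\in\mathbb N$, a map $A\in C^0(\mathbb R_{\ge0}\times\mathbb R^\ell\times\mathbb R^k;\mathbb R^{n\times n})$ and a constant $L>1$ such that, for this $R$, the following two hypotheses hold. (A1) For every $t_0\ge0$ and $\xi>0$ there exists a set-valued map $[t_0,\infty)\ni t\mapsto Q_R(t)=Q_{R,t_0,\xi}(t)\subset\mathbb R^\ell$ satisfying the CP such that for every $t\ge t_0$, every $y\in Y_R(t):=\{y\in\mathbb R^k: y=H(t)x,\ |x|\le\beta(t,t_0,R)\}$ and all $x,z\in\mathbb R^n$ with $|x|\le\beta(t,t_0,R)$ and $|x-z|\le\xi$ one has $F(t,x,y)-F(t,z,y)=A(t,q,y)(x-z)$ for some $q\in Q_R(t)$. (A2) There exists a constant $\varepsilon_R>0$ (independent of $L$) such that for every $t_0\ge0$, $\xi>0$, with $Q_R=Q_{R,t_0,\xi}$, and for every $\bar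 t_0\ge t_0$, $\tau_0>0$ and $y\in Y(\mathbb R_{\ge0},M)\cap C^0([t_0,\infty);\mathbb R^k)$ there exist a time-varying symmetric matrix $P_R=P_{R,t_0,\bar t_0,\tau_0,\xi,y}\in C^1([\bar t_0,\infty);\mathbb R^{n\times n})$ and a function $d_R=d_{R,t_0,\bar t_0,\tau_0,\xi,y}\in C^0([\bar t_0,\infty);\mathbb R)$, both $\tau_0$-noncausal with respect to $Y(\mathbb R_{\ge0},M)$, with $$P_R(t)\ge I_{n\times n}\ \ \forall t\ge\bar t_0,\qquad |P_R(\bar t_0)|\le L,$$ $$\int_{\bar t_0}^t d_R(s)\,ds>-\varepsilon_R\ \ \forall t\ge\bar t_0,\qquad \int_{\bar t_0}^\infty d_R(s)\,ds=\infty,$$ and moreover, provided that $y\in Y(\mathbb R_{\ge0},B_R\cap M)\cap C^0([t_0,\infty);\mathbb R^k)$, $$e'P_R(t)A(t,q,y(t))e+\tfrac12e'\dot P_R(t)e\le-d_R(t)e'P_R(t)e\quad\forall t\ge\bar t_0,\ e\in\ker H(t),\ q\in Q_R(t).$$ Then the AC-ODP is solvable for the system with respect to $Y(\mathbb R_{\ge0},B_R\cap M)$. Particularly, for each $\bar t_0\ge t_0\ge0$, $\tau>0$, $\bar\varepsilon_R>\varepsilon_R$, each constant $\xi\ge\beta(\bar t_0,t_0,R)\sqrt L\exp[\bar\varepsilon_R]$ and every $y\in Y(\mathbb R_{\ge0},B_R\cap M)\cap C^0([t_0,\infty);\mathbb R^k)$, there exist a time-varying symmetric matrix $P_R\in C^1([\bar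 t_0,\infty);\mathbb R^{n\times n})$ satisfying $P_R(t)\ge I_{n\times n}$ for all $t\ge\bar t_0$ and $|P_R(\bar t_0)|\le L$, and functions $\bar d_R\in C^0([\bar t_0,\infty);\mathbb R)$, $\phi_R\in C^1([\bar t_0,\infty);\mathbb R_{>0})$, all $\tau$-noncausal with respect to $Y(\mathbb R_{\ge0},B_R\cap M)$, such that, with $Q_R=Q_{R,t_0,\xi}$ from (A1) and $d_R$ a function as in (A2) (for the given $R,t_0,\bar t_0,\xi,y$ and some $\tau_0\in(0,\tau)$), $$\bar d_R(t)<d_R(t)\ \ \forall t\ge\bar t_0,\qquad \int_{\bar t_0}^t\bar d_R(s)\,ds>-\bar\varepsilon_R\ \ \forall t\ge\bar t_0,\qquad\int_{\bar t_0}^\infty\bar d_R(s)\,ds=\infty,$$ $$e'P_R(t)A(t,q,y(t))e+\tfrac12e'\dot P_R(t)e-\phi_R(t)|H(t)e|^2\le-\bar d_R(t)e'P_R(t)e\quad\forall t\ge\bar t_0,\ e\in\mathbb R^n,\ q\in Q_R(t),$$ and such that: (i) the system $\dot z=F(t,z,y)+\phi_R(t)P_R^{-1}(t)H'(t)(y-H(t)z)$ with initial condition $z(\bar t_0)=0$ is forward complete (its solution $z(\cdot)=z(\cdot,\bar t_0,0)$ exists for all $t\ge\bar t_0$) and is an observer for the given system (that is, $e(t):=x(t)-z(t)\to0$ as $t\to\infty$); (ii) the error $e(t)=x(t)-z(t)$ between the trajectory $x(\cdot)=x(\cdot,t_0,x_0)$ of the system with output $y$ and $z(\cdot)=z(\cdot,\bar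 t_0,0)$ satisfies $$|e(t)|<\beta(\bar t_0,t_0,R)\sqrt L\,\exp\Big[\int_{\bar t_0}^t-\bar d_R(s)\,ds\Big]\quad\forall t\ge\bar t_0.$$
   Context: Notation: $|x|$ is the Euclidean norm, $|A|=\max\{|Ax|:|x|=1\}$ the induced matrix norm, $A'$ the transpose, $B_R$ the closed ball of radius $R$ centered at $0\in\mathbb R^n$, $\mathrm{cl}$ the closure; matrix inequalities are in the sense of quadratic forms. $N$ is the class of increasing continuous functions $\mathbb R_{\ge0}\to\mathbb R_{\ge0}$; $NNN$ is the class of continuous functions $\beta:(\mathbb R_{\ge0})^3\to\mathbb R_{\ge0}$ that belong to $N$ with respect to each of their three arguments. CP (Compactness Property): a set-valued map $[t_0,\infty)\ni t\mapsto Q(t)\subset\mathbb R^\ell$ satisfies the CP if for every sequence $t_\nu\to t$ in $[t_0,\infty)$ and $q_\nu\in Q(t_\nu)$ there are a subsequence $(q_{\nu_k})$ and $q\in Q(t)$ with $q_{\nu_k}\to q$. Forward completeness and outputs: for a system $\dot x=f(t,x)$ with output $y=h(t,x)$ (here $f(t,x)=F(t,x,H(t)x)$, $h(t,x)=H(t)x$), $x(\cdot,t_0,x_0)$ is the solution with $x(t_0)=x_0$. The system is $M$-forward complete if there is $\beta\in NNN$ with $|x(t,t_0,x_0)|\le\beta(t,t_0,|x_0|)$ for all $t\ge t_0\ge0$, $x_0\in M$; this $\beta$ is fixed. For $I\subset\mathbb R_{\ge0}$, $Y(I,M)$ is the set of all outputs $y:[t_0,\infty)\to\mathbb R^k$,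 $y(t)=h(t,x(t,t_0,x_0))$, with $(t_0,x_0)\in I\times M$. Causality: let $\Omega$ be a set of functions $y:[t_0,\infty)\to\mathbb R^k$ parameterized by initial data $(t_0,x_0)$, and $0\le\tau\le\infty$. An object $a_{t_0,y}$ (a function of time $t$ in a subinterval of $[t_0,\infty)$ and possibly of further variables, possibly depending on further fixed parameters) assigned to each $y\in\Omega\cap C^0([t_0,\infty);\mathbb R^k)$ is $\tau$-noncausal with respect to $\Omega$ if its value at time $t$ depends only on the values $y(s)$, $t_0\le s\le t+\tau$, of $y$. When, for every $y$, existence of a $\tau$-noncausal object is asserted, the objects are understood as such a family indexed by $y$. AC-ODP (Almost Causal Observer Design Problem): it is solvable for the system with respect to $Y(\mathbb R_{\ge0},M)$ if for every $\bar t_0\ge t_0\ge0$, $\tau>0$ and $y\in Y(\mathbb R_{\ge0},M)\cap C^0([t_0,\infty);\mathbb R^k)$ there exist a continuous map $g=g_{\bar t_0,y}(t,z,w):[\bar t_0,\infty)\times\mathbb R^n\times\mathbb R^k\to\mathbb R^n$, $\tau$-noncausal with respect to $Y(\mathbb R_{\ge0},M)$, and a nonempty set $\bar M\subset\mathbb R^n$ such that for every $z_0\in\bar M$ the trajectory $z(\cdot)$ of $\dot z=g(t,z,y(t))$, $z(\bar t_0)=z_0$, exists for all $t\ge\bar t_0$ and $\lim_{t\to\infty}(x(t)-z(t))=0$, where $x(\cdot)=x(\cdot,t_0,x_0)$, $x_0\in M$, is the trajectory of the system with output $y$. For $Y(\mathbb R_{\ge0},B_R\cap M)$ replace $M$ by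 $B_R\cap M$ throughout. *)

(* Defs.v *)
From HB Require Import structures.
From mathcomp Require Import all_boot all_order all_algebra.
From mathcomp Require Import all_classical all_reals all_analysis.

Set Implicit Arguments.
Unset Strict Implicit.
Unset Printing Implicit Defensive.

Import Order.TTheory GRing.Theory Num.Theory.
Import numFieldNormedType.Exports.

Local Open Scope classical_set_scope.
Local Open Scope ring_scope.

(* The library norm of a matrix is the sup norm of its entries; it induces the
   usual topology, but bounds in the statement are about the Euclidean norm
   [enorm] and about the operator norm [opnorm] it induces. *)
Definition enorm (R : realType) (n : nat) (x : 'cV[R]_n) : R :=
  Num.sqrt (\sum_(i < n) x i 0 ^+ 2).

(* The supremum is attained, as the unit sphere is compact. *)
Definition opnorm (R : realType) (m n : nat) (A : 'M[R]_(m, n)) : R :=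
  sup [set enorm (A *m x) | x in [set x : 'cV[R]_n | enorm x = 1]].

Definition eball (R : realType) (n : nat) (r : R) : set 'cV[R]_n :=
  [set x | enorm x <= r].

Definition qform (R : realType) (n : nat) (A : 'M[R]_n) (e : 'cV[R]_n) : R :=
  (e^T *m A *m e) 0 0.

Definition mxform_ge (R : realType) (n : nat) (A B : 'M[R]_n) : Prop :=
  forall e : 'cV[R]_n, qform B e <= qform A e.

(* "Increasing" is strict. With non-strict monotonicity beta could vanish,
   and no strict inequality |e(t)| < beta(...) * ... could hold. *)
Definition classN (R : realType) (g : R -> R) : Prop :=
  [/\ {within `[0, +oo[, continuous g},
      forall s, 0 <= s -> 0 <= g s &
      forall s t, 0 <= s -> s < t -> g s < g t].

Definition classNNN (R : realType) (b : R -> R -> R -> R) : Prop :=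
  {within [set p : R * R * R | [/\ 0 <= p.1.1, 0 <= p.1.2 & 0 <= p.2]],
     continuous (fun p : R * R * R => b p.1.1 p.1.2 p.2)} /\
  forall u v : R, 0 <= u -> 0 <= v ->
    [/\ classN (fun s => b s u v), classN (fun s => b u s v) &
        classN (fun s => b u v s)].

(* Functions on [a, +oo) are represented by total functions on R, of which only
   the values on [a, +oo) matter. Derivatives are taken relative to [a, +oo):
   two-sided at t > a, right-sided at t = a. *)
Definition diffq (R : realType) (V : normedModType R) (f : R -> V) (t : R) :
    R -> V :=
  fun s => (s - t)^-1 *: (f s - f t).

Definition has_deriv_from (R : realType) (V : normedModType R) (a : R)
    (f : R -> V) (t : R) (l : V) : Prop :=
  diffq f t @ within `[a, +oo[ t^' --> l.

Definition deriv_from (R : realType) (V : normedModType R) (a : R)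
    (f : R -> V) (t : R) : V :=
  lim (diffq f t @ within `[a, +oo[ t^').

Definition C1_from (R : realType) (V : normedModType R) (a : R)
    (f : R -> V) : Prop :=
  (forall t, a <= t -> has_deriv_from a f t (deriv_from a f t)) /\
  {within `[a, +oo[, continuous (deriv_from a f)}.

Definition solution (R : realType) (n : nat) (f : R -> 'cV[R]_n -> 'cV[R]_n)
    (t0 : R) (x0 : 'cV[R]_n) (x : R -> 'cV[R]_n) : Prop :=
  x t0 = x0 /\ forall t, t0 <= t -> has_deriv_from t0 x t (f t (x t)).

Definition forward_complete (R : realType) (n : nat)
    (f : R -> 'cV[R]_n -> 'cV[R]_n) (M : set 'cV[R]_n)
    (beta : R -> R -> R -> R) : Prop :=
  forall (t0 : R) (x0 : 'cV[R]_n), 0 <= t0 -> M x0 ->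
    (exists x, solution f t0 x0 x) /\
    forall x, solution f t0 x0 x ->
      forall t, t0 <= t -> enorm (x t) <= beta t t0 (enorm x0).

Definition traj_with_output (R : realType) (n k : nat)
    (f : R -> 'cV[R]_n -> 'cV[R]_n) (h : R -> 'cV[R]_n -> 'cV[R]_k)
    (M : set 'cV[R]_n) (t0 : R) (y : R -> 'cV[R]_k) (x : R -> 'cV[R]_n) :
    Prop :=
  (exists2 x0, M x0 & solution f t0 x0 x) /\
  forall t, t0 <= t -> y t = h t (x t).

(* [outputs f h M t0] is the intersection of Y(R_{>=0}, M) with
   C^0([t0, +oo); R^k): the domain [t0, +oo) of an output determines its
   initial time. *)
Definition outputs (R : realType) (n k : nat)
    (f : R -> 'cV[R]_n -> 'cV[R]_n) (h : R -> 'cV[R]_n -> 'cV[R]_k)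
    (M : set 'cV[R]_n) (t0 : R) : set (R -> 'cV[R]_k) :=
  [set y | (exists x, traj_with_output f h M t0 y x) /\
           {within `[t0, +oo[, continuous y}].

(* A family [a y t], indexed by the outputs y in [Y] and defined for t >= tb,
   whose value at time t depends only on y(s) for t0 <= s <= t + tau. *)
Definition noncausal (R : realType) (k : nat) (T : Type) (tau t0 tb : R)
    (Y : set (R -> 'cV[R]_k)) (a : (R -> 'cV[R]_k) -> R -> T) : Prop :=
  forall y1 y2, Y y1 -> Y y2 -> forall t, tb <= t ->
    (forall s, t0 <= s -> s <= t + tau -> y1 s = y2 s) -> a y1 t = a y2 t.

Definition CP (R : realType) (l : nat) (t0 : R) (Q : R -> set 'cV[R]_l) : Prop :=
  forall (u : nat -> R) (t : R) (q : nat -> 'cV[R]_l),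
    (forall i, t0 <= u i) -> t0 <= t -> u @ \oo --> t ->
    (forall i, Q (u i) (q i)) ->
    exists (sigma : nat -> nat) (q0 : 'cV[R]_l),
      [/\ {homo sigma : i j / (i < j)%N}, Q t q0 & (q \o sigma) @ \oo --> q0].

Definition ACODP_solvable (R : realType) (n k : nat)
    (f : R -> 'cV[R]_n -> 'cV[R]_n) (h : R -> 'cV[R]_n -> 'cV[R]_k)
    (M : set 'cV[R]_n) : Prop :=
  forall t0 tb tau : R, 0 <= t0 -> t0 <= tb -> 0 < tau ->
  exists g : (R -> 'cV[R]_k) -> R -> 'cV[R]_n -> 'cV[R]_k -> 'cV[R]_n,
    noncausal tau t0 tb (outputs f h M t0) g /\
    forall y, outputs f h M t0 y ->
      {within [set p : R * 'cV[R]_n * 'cV[R]_k | tb <= p.1.1],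
         continuous (fun p : R * 'cV[R]_n * 'cV[R]_k => g y p.1.1 p.1.2 p.2)} /\
      exists Mbar : set 'cV[R]_n, Mbar !=set0 /\
        forall z0, Mbar z0 ->
          (exists z, solution (fun t w => g y t w (y t)) tb z0 z) /\
          forall x z, traj_with_output f h M t0 y x ->
            solution (fun t w => g y t w (y t)) tb z0 z ->
            (fun t => x t - z t) @ +oo --> (0 : 'cV[R]_n).

Definition loc_lipschitz (R : realType) (n k m : nat)
    (F : R -> 'cV[R]_n -> 'cV[R]_k -> 'cV[R]_m) : Prop :=
  forall (t0 : R) (x0 : 'cV[R]_n) (y0 : 'cV[R]_k), 0 <= t0 ->
  exists r C : R, 0 < r /\
    forall t x1 x2 y1 y2, 0 <= t -> `|t - t0| < r ->
      enorm (x1 - x0) < r -> enorm (x2 - x0) < r ->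
      enorm (y1 - y0) < r -> enorm (y2 - y0) < r ->
      enorm (F t x1 y1 - F t x2 y2) <= C * (enorm (x1 - x2) + enorm (y1 - y2)).

Definition integral_from (R : realType) (a t : R) (d : R -> R) : R :=
  \int[lebesgue_measure]_(s in `[a, t]) d s.

(* Main.v *)
(* For a solution z of the observer, e = x - z and V = e' P e satisfy, as long
   as |e| <= xi, V' <= -2 d1 V: (A1) turns F(t,x,y) - F(t,z,y) into A e, and the
   output injection contributes exactly -2 phi |H e|^2, which upgrades the
   inequality of (A2) from ker H(t) to all directions. Since P >= I and
   |P(tb)| <= L, this gives |e(t)| < B sqrt(L) exp(-int db) <= xi with
   B = beta(tb,t0,R), so the restriction |e| <= xi is never reached.

   The rates are db < d1 < d, with d - d1 and d1 - db multiples of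
   exp(-(t - tb)) whose integrals are controlled by epsb - epsR; the gap
   between d1 and db makes the final estimate strict.

   The gain phi must be C^1 and noncausal with horizon tau. With tau0 = tau/2
   and a grid of step tau/8, (CP) and compactness of the sphere yield on each
   cell a constant penalty that works there (Finsler's lemma); a canonical
   choice of it depends only on the output up to the end of the cell plus tau0,
   and a C^1 function above these constants needs to look only one cell ahead.

   The observer has a solution because clipping x - z to a box makes its right
   hand side globally Lipschitz, so that Picard iteration converges on the whole
   half-line, and the estimate above shows that the clipping is inactive. *)
Require Import Defs.
From HB Require Import structures.
From mathcomp Require Import all_boot all_order all_algebra.
From mathcomp Require Import all_classical all_reals all_analysis.
From mathcomp Require Import ring lra.
Set Implicit Arguments.
Unset Strict Implicit.
Unset Printing Implicit Defensive.
Import Order.TTheory GRing.Theory Num.Theory.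
Import numFieldNormedType.Exports.
Local Open Scope classical_set_scope.
Local Open Scope ring_scope.

(** * Limits of matrices, Euclidean and operator norms *)

Lemma cvg_mx (R : realType) (m n : nat) (T : Type) (G : set_system T)
    {FG : Filter G} (f : T -> 'M[R]_(m, n)) (a : 'M[R]_(m, n)) :
  (forall i j, f x i j @[x --> G] --> a i j) -> f @ G --> a.
Proof.
move=> fa; apply/cvgrPdist_le => e e0.
have : \forall x \near G, forall ij : 'I_m * 'I_n,
    `|a ij.1 ij.2 - f x ij.1 ij.2| <= e.
  apply: filter_forall => -[i j] /=.
  by have /cvgrPdist_le /(_ e e0) := fa i j.
apply: filterS => x fx.
rewrite [leLHS]/Num.norm/= mx_normrE (bigmax_le _ (ltW e0))//= => ij _.
by rewrite !mxE /=; exact: fx.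
Qed.

Lemma cvg_coord (R : realType) (m n : nat) (T : Type) (G : set_system T)
    {FG : Filter G} (f : T -> 'M[R]_(m, n)) (a : 'M[R]_(m, n)) i j :
  f @ G --> a -> f x i j @[x --> G] --> a i j.
Proof.
move=> fa; exact: (cvg_comp f (fun M : 'M[R]_(m, n) => M i j) fa
  (@coord_continuous R m n i j a)).
Qed.

Lemma cvg_sumr (R : realType) (T : Type) (G : set_system T)
    {FG : Filter G} (I : Type) (r : seq I) (P : pred I)
    (f : I -> T -> R) (a : I -> R) :
  (forall i, P i -> f i x @[x --> G] --> a i) ->
  (\sum_(i <- r | P i) f i x) @[x --> G] --> \sum_(i <- r | P i) a i.
Proof. by apply: cvg_big; exact: add_continuous. Qed.

Lemma cvg_prodr (R : realType) (T : Type) (G : set_system T)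
    {FG : Filter G} (I : Type) (r : seq I) (P : pred I)
    (f : I -> T -> R) (a : I -> R) :
  (forall i, P i -> f i x @[x --> G] --> a i) ->
  (\prod_(i <- r | P i) f i x) @[x --> G] --> \prod_(i <- r | P i) a i.
Proof. by apply: cvg_big; exact: mul_continuous. Qed.

Lemma cvg_mulmx (R : realType) (m n p : nat) (T : Type) (G : set_system T)
    {FG : Filter G} (f : T -> 'M[R]_(m, n)) (g : T -> 'M[R]_(n, p)) (a : 'M[R]_(m, n)) (b : 'M[R]_(n, p)) :
  f @ G --> a -> g @ G --> b -> (f x *m g x) @[x --> G] --> a *m b.
Proof.
move=> fa gb; apply: cvg_mx => i j; rewrite !mxE.
under eq_fun do rewrite mxE.
by apply: cvg_sumr => h _; apply: cvgM; exact: cvg_coord.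
Qed.

Lemma cvg_trmx (R : realType) (m n : nat) (T : Type) (G : set_system T)
    {FG : Filter G} (f : T -> 'M[R]_(m, n)) (a : 'M[R]_(m, n)) :
  f @ G --> a -> (f x)^T @[x --> G] --> a^T.
Proof.
move=> fa; apply: cvg_mx => i j; rewrite !mxE.
by under eq_fun do rewrite mxE; exact: cvg_coord.
Qed.

Lemma cvg_det (R : realType) (n : nat) (T : Type) (G : set_system T)
    {FG : Filter G} (f : T -> 'M[R]_n) (a : 'M[R]_n) :
  f @ G --> a -> \det (f x) @[x --> G] --> \det a.
Proof.
move=> fa; apply: cvg_sumr => s _.
apply: cvgM; first exact: cvg_cst.
by apply: cvg_prodr => i _; exact: cvg_coord.
Qed.

(** By Cramer's rule the inverse is the adjugate over the determinant, both polynomial in the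
    entries. Invertibility is asked near the limit because [invmx] returns its argument on singular
    matrices. *)
Lemma cvg_invmx (R : realType) (n : nat) (T : Type) (G : set_system T)
    {FG : Filter G} (f : T -> 'M[R]_n) (a : 'M[R]_n) :
  (\forall x \near G, f x \in unitmx) -> a \in unitmx ->
  f @ G --> a -> invmx (f x) @[x --> G] --> invmx a.
Proof.
move=> uf ua fa.
have -> : invmx a = (\det a)^-1 *: \adj a by rewrite /invmx ua.
have : ((\det (f x))^-1 *: \adj (f x)) @[x --> G] --> (\det a)^-1 *: \adj a.
  apply: cvgZ.
    apply: cvgV; last exact: cvg_det.
    by move: ua; rewrite unitmxE unitfE.
  apply: cvg_mx => i j; rewrite mxE; under eq_fun do rewrite mxE.
  apply: cvgM; first exact: cvg_cst.
  apply: cvg_det; apply: cvg_mx => k l; rewrite !mxE.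
  by under eq_fun do rewrite !mxE; exact: cvg_coord.
apply: cvg_trans; apply: near_eq_cvg; near=> x.
by rewrite /invmx (_ : f x \in unitmx = true)//; near: x.
Unshelve. all: by end_near. Qed.

Lemma cvg_qform (R : realType) (n : nat) (T : Type) (G : set_system T)
    {FG : Filter G} (f : T -> 'M[R]_n) (g : T -> 'cV[R]_n) (a : 'M[R]_n) (b : 'cV[R]_n) :
  f @ G --> a -> g @ G --> b -> qform (f x) (g x) @[x --> G] --> qform a b.
Proof.
move=> fa gb; apply: cvg_coord; apply: cvg_mulmx => //.
by apply: cvg_mulmx => //; exact: cvg_trmx.
Qed.

Lemma enorm_ge0 (R : realType) (n : nat) (x : 'cV[R]_n) : 0 <= enorm x.
Proof. exact: sqrtr_ge0. Qed.

Lemma enorm0 (R : realType) (n : nat) : enorm (0 : 'cV[R]_n) = 0.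
Proof. by rewrite /enorm big1 ?sqrtr0// => i _; rewrite mxE expr0n. Qed.

Lemma enorm_sqr (R : realType) (n : nat) (x : 'cV[R]_n) :
  enorm x ^+ 2 = (x^T *m x) 0 0.
Proof.
rewrite sqr_sqrtr; last by apply: sumr_ge0 => i _; exact: sqr_ge0.
by rewrite mxE; apply: eq_bigr => i _; rewrite mxE expr2.
Qed.

Lemma cvg_enorm (R : realType) (n : nat) (T : Type) (G : set_system T)
    {FG : Filter G} (f : T -> 'cV[R]_n) (a : 'cV[R]_n) :
  f @ G --> a -> enorm (f x) @[x --> G] --> enorm a.
Proof.
move=> fa; apply: (cvg_comp _ Num.sqrt); last exact: sqrt_continuous.
apply: cvg_sumr => i _; under eq_fun do rewrite expr2.
by rewrite expr2; apply: cvgM; exact: cvg_coord.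
Qed.

Lemma qform1 (R : realType) (n : nat) (x : 'cV[R]_n) :
  qform 1%:M x = enorm x ^+ 2.
Proof. by rewrite /qform mulmx1 enorm_sqr. Qed.

Lemma qformZ (R : realType) (n : nat) (A : 'M[R]_n) (c : R) (x : 'cV[R]_n) :
  qform A (c *: x) = c ^+ 2 * qform A x.
Proof.
rewrite /qform; have -> : (c *: x)^T = c *: x^T by apply/matrixP => i j; rewrite !mxE.
by rewrite -!scalemxAl -scalemxAr !mxE expr2 mulrA.
Qed.

Lemma enormZ (R : realType) (n : nat) (c : R) (x : 'cV[R]_n) :
  enorm (c *: x) = `|c| * enorm x.
Proof.
apply: (@pexpIrn _ 2) => //; rewrite ?nnegrE ?enorm_ge0 ?mulr_ge0 ?enorm_ge0//.
by rewrite -qform1 qformZ qform1 exprMn real_normK ?num_real.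
Qed.

Lemma le_coord_enorm (R : realType) (n : nat) (x : 'cV[R]_n) i :
  `|x i 0| <= enorm x.
Proof.
rewrite -sqrtr_sqr ler_sqrt ?sumr_ge0// => [|j _]; last exact: sqr_ge0.
by rewrite (bigD1 i) //= lerDl sumr_ge0// => j _; exact: sqr_ge0.
Qed.

Lemma le_coord_norm (R : realType) (m n : nat) (x : 'M[R]_(m, n)) i j :
  `|x i j| <= `|x|.
Proof.
rewrite [leRHS]/Num.norm/= mx_normrE.
exact: (le_bigmax 0 (fun ij => `|x ij.1 ij.2|) (i, j)).
Qed.

Lemma norm_mx_le (R : realType) (m n : nat) (x : 'M[R]_(m, n)) (c : R) :
  0 <= c -> (forall i j, `|x i j| <= c) -> `|x| <= c.
Proof.
by move=> c0 xc; rewrite [leLHS]/Num.norm/= mx_normrE bigmax_le.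
Qed.

Lemma norm_le_enorm (R : realType) (n : nat) (x : 'cV[R]_n) : `|x| <= enorm x.
Proof.
apply: norm_mx_le; first exact: enorm_ge0.
by move=> i j; rewrite ord1 le_coord_enorm.
Qed.

Lemma enorm_le_norm (R : realType) (n : nat) (x : 'cV[R]_n) :
  enorm x <= n%:R * `|x|.
Proof.
rewrite -[leRHS]ger0_norm ?mulr_ge0// -sqrtr_sqr ler_wsqrtr//.
apply: (@le_trans _ _ (\sum_(i < n) `|x| ^+ 2)).
  apply: ler_sum => i _; rewrite -real_normK ?num_real//.
  by rewrite lerXn2r ?nnegrE ?normr_ge0// le_coord_norm.
rewrite sumr_const card_ord exprMn -[leLHS]mulr_natl ler_wpM2r ?sqr_ge0//.
by rewrite expr2 -natrM ler_nat; case: n x => // n _; rewrite leq_pmulr.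
Qed.

Lemma enorm_eq0 (R : realType) (n : nat) (x : 'cV[R]_n) :
  enorm x = 0 -> x = 0.
Proof.
by move=> x0; apply/normr0_eq0/eqP; rewrite eq_le normr_ge0 -x0 norm_le_enorm.
Qed.

Lemma norm_mulmx_le (R : realType) (m n p : nat)
    (A : 'M[R]_(m, n)) (B : 'M[R]_(n, p)) :
  `|A *m B| <= n%:R * `|A| * `|B|.
Proof.
apply: norm_mx_le => [|i j]; first by rewrite !mulr_ge0.
rewrite mxE (le_trans (ler_norm_sum _ _ _))//.
apply: (@le_trans _ _ (\sum_(k < n) `|A| * `|B|)).
  by apply: ler_sum => k _; rewrite normrM ler_pM// le_coord_norm.
by rewrite sumr_const card_ord -[leLHS]mulr_natl mulrA.
Qed.

(** Equivalence of the Euclidean and sup norms bounds the set under the supremum, so [sup] is a true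
    upper bound; a nonzero vector is then scaled to the unit sphere. *)
Lemma opnormP (R : realType) (n : nat) (A : 'M[R]_n) (x : 'cV[R]_n) :
  enorm (A *m x) <= opnorm A * enorm x.
Proof.
have [/enorm_eq0 ->|x0] := eqVneq (enorm x) 0.
  by rewrite mulmx0 !enorm0 mulr0.
have xp : 0 < enorm x by rewrite lt_def x0 enorm_ge0.
rewrite -ler_pdivrMr// mulrC -[X in X * _]ger0_norm ?invr_ge0 ?enorm_ge0//.
rewrite -enormZ scalemxAr; apply: ub_le_sup; last first.
  by exists ((enorm x)^-1 *: x) => //=; rewrite enormZ ger0_norm ?invr_ge0 ?ltW// mulVf.
exists (n%:R * (n%:R * `|A| * 1)) => _ [y /= y1 <-].
rewrite (le_trans (enorm_le_norm _))// ler_wpM2l// (le_trans (norm_mulmx_le _ _))//.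
by rewrite ler_wpM2l ?mulr_ge0// -y1 norm_le_enorm.
Qed.

(* AM-GM replaces Cauchy-Schwarz:
   [2 x'(Ax) <= c |x|^2 + |Ax|^2 / c] for [c] at least the norm of [A]. *)
Lemma qform_le_opnorm (R : realType) (n : nat) (A : 'M[R]_n) (c : R)
    (x : 'cV[R]_n) :
  0 < c -> opnorm A <= c -> qform A x <= c * enorm x ^+ 2.
Proof.
move=> c0 Ac; set w := A *m x.
have wle : enorm w ^+ 2 <= c ^+ 2 * enorm x ^+ 2.
  have h : enorm w <= c * enorm x.
    by rewrite /w (le_trans (opnormP _ _))// ler_wpM2r ?enorm_ge0.
  by rewrite -exprMn lerXn2r ?nnegrE ?enorm_ge0 ?(mulr_ge0 (ltW c0)) ?enorm_ge0.
have : 0 <= enorm (c *: x - w) ^+ 2 by exact: sqr_ge0.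
have -> : enorm (c *: x - w) ^+ 2 =
    c ^+ 2 * enorm x ^+ 2 - 2 * c * qform A x + enorm w ^+ 2.
  rewrite !sqr_sqrtr ?sumr_ge0//; try by move=> i _; exact: sqr_ge0.
  rewrite /qform -mulmxA mxE -/w !mulr_sumr -sumrN -!big_split /=.
  by apply: eq_bigr => i _; rewrite !mxE; ring.
move=> h; rewrite -(ler_pM2l c0); nra.
Qed.

Lemma mxform_ge1_unit (R : realType) (n : nat) (A : 'M[R]_n) :
  mxform_ge A 1%:M -> A \in unitmx.
Proof.
(* [kermx] is a left kernel: its rows for the transpose of [A] are the transposed vectors killed by
   [A]. On such a vector the form of [A] vanishes although it dominates the squared norm. *)
move=> A1; rewrite -unitmx_tr -row_free_unit -kermx_eq0.
apply/eqP/row_matrixP => i; rewrite row0.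
set v := row i _.
have vA : v *m A^T = 0 by rewrite -row_mul mulmx_ker row0.
have : A *m v^T = 0 by rewrite -[A]trmxK -trmx_mul vA trmx0.
move=> Av; have := A1 v^T; rewrite qform1 /qform -mulmxA Av mulmx0 mxE.
rewrite real_exprn_even_le0 ?num_real//= => /eqP/enorm_eq0 /(congr1 trmx).
by rewrite trmxK trmx0.
Qed.

(** * Continuity and derivatives on a half-line *)

Lemma continuous_fromP (R : realType) (U : topologicalType) (a : R)
    (f : R -> U) :
  {within `[a, +oo[, continuous f} <->
  forall t, a <= t -> f @ within `[a, +oo[ (nbhs t) --> f t.
Proof.
by rewrite subspace_continuousP; split => h t at_; apply: h;
  move: at_; rewrite /= in_itv/= andbT.
Qed.

Lemma within_continuous_comp (S T U : topologicalType) (D : set T)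
    (f : T -> U) (g : S -> T) :
  {within D, continuous f} -> continuous g -> (forall s, D (g s)) ->
  continuous (f \o g).
Proof.
move=> /subspace_continuousP fD gc gD s.
have := fD (g s) (gD s); apply: cvg_comp.
move=> P; rewrite /within /= => PD.
have gs : \forall r \near s, D (g r) -> P (g r) := gc s _ PD.
by apply: filterS gs => r; apply; exact: gD.
Qed.

Lemma continuous_maxl (R : realType) (a : R) : continuous (Num.max a).
Proof. by move=> x; apply: continuous_max; [exact: cvg_cst|exact: cvg_id]. Qed.

(** Freezing a function at [a] on the left of [a] makes continuity on the half-line global. All data
    known only on a half-line are extended in this way. *)
Lemma continuous_from_max (R : realType) (U : topologicalType) (a : R)
    (f : R -> U) :
  {within `[a, +oo[, continuous f} -> continuous (fun t => f (Num.max a t)).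
Proof.
move=> fa; apply: (within_continuous_comp fa (@continuous_maxl R a)) => s.
by rewrite /= in_itv/= andbT le_max lexx.
Qed.

Lemma near_from (R : realType) (a t : R) :
  \forall s \near within `[a, +oo[ (nbhs t), a <= s.
Proof.
rewrite near_withinE; near=> s => /=; rewrite in_itv/= andbT; exact.
Unshelve. all: by end_near. Qed.

Lemma continuous_from_eq (R : realType) (U : topologicalType) (a : R)
    (f g : R -> U) :
  (forall t, a <= t -> f t = g t) -> continuous g ->
  {within `[a, +oo[, continuous f}.
Proof.
move=> fg gc; apply/continuous_fromP => t at_; rewrite fg//.
apply: (@cvg_trans _ (g @ within `[a, +oo[ (nbhs t))); last first.
  exact: cvg_trans (cvg_app g (cvg_within `[a, +oo[)) (gc t).
apply: near_eq_cvg; near=> s; rewrite fg//.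
by near: s; exact: near_from.
Unshelve. all: by end_near. Qed.

Lemma near_dnbhs_from (R : realType) (a t : R) (P : set R) :
  (within `[a, +oo[ t^') P <->
  exists2 e, 0 < e & forall s, a <= s -> s != t -> `|t - s| < e -> P s.
Proof.
split=> [[e /= e0 eP]|[e e0 eP]]; exists e => //= s.
- by move=> as_ st es; apply: eP => //=; rewrite in_itv/= as_.
- by move=> es st /=; rewrite in_itv/= andbT => as_; exact: eP.
Qed.

Lemma dnbhs_from_proper (R : realType) (a t : R) :
  a <= t -> ProperFilter (within `[a, +oo[ t^').
Proof.
move=> at_; apply: Build_ProperFilter_ex => P /near_dnbhs_from[e e0 eP].
exists (t + e / 2); apply: eP.
- by rewrite (le_trans at_)// lerDl divr_ge0// ltW.
- by rewrite gt_eqF// ltrDl divr_gt0.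
- by rewrite opprD addrA subrr sub0r normrN gtr0_norm ?divr_gt0//; lra.
Qed.

Lemma has_deriv_from_uniq (R : realType) (V : normedModType R) (a t : R)
    (f : R -> V) (l : V) :
  a <= t -> has_deriv_from a f t l -> deriv_from a f t = l.
Proof.
move=> at_ fl; have PF := dnbhs_from_proper at_.
by apply: cvg_lim => //; exact: norm_hausdorff.
Qed.

Lemma has_deriv_from_le (R : realType) (V : normedModType R) (a b t : R)
    (f : R -> V) (l : V) :
  a <= b -> has_deriv_from a f t l -> has_deriv_from b f t l.
Proof.
move=> ab; apply: cvg_trans => P /near_dnbhs_from[e e0 eP].
apply/near_dnbhs_from; exists e => // s bs; apply: eP.
exact: le_trans bs.
Qed.

(** Away from [t], the value [f s] is [f t] plus [s - t] times a convergent quotient. *)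
Lemma has_deriv_from_cvg (R : realType) (V : normedModType R) (a t : R)
    (f : R -> V) (l : V) :
  has_deriv_from a f t l -> f @ within `[a, +oo[ t^' --> f t.
Proof.
move=> fl.
have : (f t + (s - t) *: diffq f t s) @[s --> within `[a, +oo[ t^'] -->
    f t + (t - t) *: l.
  have st : (s - t) @[s --> within `[a, +oo[ t^'] --> t - t.
    apply: cvgB; last exact: cvg_cst.
    exact: cvg_trans (cvg_within _) (@cvg_within _ (nbhs t) _ _).
  by apply: cvgD; [exact: cvg_cst|exact: cvgZ st fl].
rewrite subrr scale0r addr0; apply: cvg_trans; apply: near_eq_cvg.
apply/near_dnbhs_from; exists 1 => // s _ st _.
by rewrite /diffq scalerA mulfV ?subr_eq0// scale1r addrC subrK.
Qed.

Lemma has_deriv_from_continuous (R : realType) (V : normedModType R) (a : R)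
    (f : R -> V) (l : R -> V) :
  (forall t, a <= t -> has_deriv_from a f t (l t)) ->
  {within `[a, +oo[, continuous f}.
Proof.
move=> fl; apply/continuous_fromP => t at_.
have /cvgrPdist_lt ft := has_deriv_from_cvg (fl t at_).
apply/cvgrPdist_lt => e e0; have /near_dnbhs_from[r r0 rP] := ft e e0.
exists r => // s /= rs; rewrite in_itv/= andbT => as_.
by have [->|st] := eqVneq s t; [rewrite subrr normr0|exact: rP].
Qed.

Lemma is_derive_has_deriv_from (R : realType) (V : normedModType R) (a t : R)
    (f : R -> V) (l : V) :
  is_derive t 1 f l -> has_deriv_from a f t l.
Proof.
move=> [df dfl]; move: df; rewrite /derivable => /cvg_ex[/= l' fl'].
have ll' : l' = l by rewrite -dfl; apply/esym/cvg_lim => //; exact: norm_hausdorff.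
subst l'; apply/cvgrPdist_lt => e e0.
have /cvgrPdist_lt /(_ e e0)[r /= r0 rP] := fl'.
apply/near_dnbhs_from; exists r => // s _ st sr.
have := rP (s - t); rewrite /ball_/= sub0r normrN subr_eq0 distrC => /(_ sr st).
by rewrite /diffq [X in f (X + _)]mulr1 subrK.
Qed.

(** At an interior point the constraint [a <= s] is void within distance [t - a], so the relative
    derivative is the two-sided one. *)
Lemma has_deriv_from_is_derive (R : realType) (V : normedModType R) (a t : R)
    (f : R -> V) (l : V) :
  a < t -> has_deriv_from a f t l -> is_derive t 1 f l.
Proof.
move=> at_ fl.
have fl' : h^-1 *: (f (h *: 1 + t) - f t) @[h --> 0^'] --> l.
  apply/cvgrPdist_lt => e e0.
  have /cvgrPdist_lt /(_ e e0)/near_dnbhs_from[r /= r0 rP] := fl.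
  exists (Num.min r (t - a)); first by rewrite /= lt_min r0 subr_gt0.
  move=> h /=; rewrite sub0r normrN lt_min => /andP[hr ha] h0.
  have := rP (h + t); rewrite [X in f (X + _)]mulr1 /diffq addrK; apply.
  - by have := ler_norm (- h); rewrite normrN; lra.
  - by rewrite -subr_eq0 addrK.
  - by rewrite opprD addrCA subrr addr0 normrN.
split; first by apply/cvg_ex; exists l.
by apply: cvg_lim => //; exact: norm_hausdorff.
Qed.

Lemma C1_from_is_derive (R : realType) (V : normedModType R) (a : R)
    (f g : R -> V) :
  (forall t, a <= t -> is_derive t 1 f (g t)) ->
  {within `[a, +oo[, continuous g} -> C1_from a f.
Proof.
move=> fg gc; have fgE t : a <= t -> deriv_from a f t = g t.
  move=> at_; apply: has_deriv_from_uniq => //.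
  by apply: is_derive_has_deriv_from; exact: fg.
split=> [t at_|]; first by rewrite fgE//; apply: is_derive_has_deriv_from; exact: fg.
apply/continuous_fromP => t at_; rewrite fgE//.
move/continuous_fromP : gc => /(_ t at_); apply: cvg_trans.
apply: near_eq_cvg; near=> s; rewrite fgE//.
by near: s; exact: near_from.
Unshelve. all: by end_near. Qed.

(** Used for noncausality: two outputs that agree slightly past [t] give the same derivative of the
    matrix [P] at [t], at the price of an extra look-ahead [r]. *)
Lemma deriv_from_near (R : realType) (V : normedModType R) (a t r : R)
    (f g : R -> V) (l l' : V) :
  a <= t -> 0 < r -> (forall s, a <= s -> s < t + r -> f s = g s) ->
  has_deriv_from a f t l -> has_deriv_from a g t l' -> l = l'.
Proof.
move=> at_ r0 fg fl; have PF := dnbhs_from_proper at_.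
apply: cvg_unique; first exact: norm_hausdorff.
move: fl; apply: cvg_trans; apply: near_eq_cvg.
apply/near_dnbhs_from; exists r => // s as_ _ sr; rewrite /diffq !fg//.
  by rewrite ltrDl.
by have := ler_norm (- (t - s)); rewrite normrN; lra.
Qed.

Lemma has_deriv_from_mulmx (R : realType) (m n p : nat) (a t : R)
    (f : R -> 'M[R]_(m, n)) (g : R -> 'M[R]_(n, p)) f' g' :
  has_deriv_from a f t f' -> has_deriv_from a g t g' ->
  has_deriv_from a (fun s => f s *m g s) t (f' *m g t + f t *m g').
Proof.
move=> ff gg; rewrite /has_deriv_from.
have -> : diffq (fun s => f s *m g s) t =
    fun s => diffq f t s *m g s + f t *m diffq g t s.
  apply/funext => s; rewrite /diffq -scalemxAl -scalemxAr -scalerDr.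
  by rewrite mulmxBl mulmxBr addrA subrK.
apply: cvgD; apply: cvg_mulmx => //; first exact: has_deriv_from_cvg gg.
exact: cvg_cst.
Qed.

Lemma has_deriv_fromB (R : realType) (V : normedModType R) (a t : R)
    (f g : R -> V) f' g' :
  has_deriv_from a f t f' -> has_deriv_from a g t g' ->
  has_deriv_from a (fun s => f s - g s) t (f' - g').
Proof.
move=> ff gg; rewrite /has_deriv_from.
have -> : diffq (fun s => f s - g s) t = fun s => diffq f t s - diffq g t s.
  apply/funext => s; rewrite /diffq -scalerBr; congr (_ *: _).
  by rewrite !opprB addrACA [RHS]addrACA [- g s + _]addrC.
exact: cvgB.
Qed.

Lemma has_deriv_from_trmx (R : realType) (m n : nat) (a t : R)
    (f : R -> 'M[R]_(m, n)) f' :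
  has_deriv_from a f t f' -> has_deriv_from a (fun s => (f s)^T) t f'^T.
Proof.
move=> ff; rewrite /has_deriv_from.
have -> : diffq (fun s => (f s)^T) t = fun s => (diffq f t s)^T.
  by apply/funext => s; apply/matrixP => i j; rewrite !mxE.
exact: cvg_trmx.
Qed.

Lemma has_deriv_from_coord (R : realType) (m n : nat) (a t : R)
    (f : R -> 'M[R]_(m, n)) f' i j :
  has_deriv_from a f t f' ->
  has_deriv_from a (fun s => f s i j : R^o) t (f' i j).
Proof.
move=> ff; rewrite /has_deriv_from.
have -> : diffq (fun s => f s i j : R^o) t = fun s => diffq f t s i j.
  by apply/funext => s; rewrite !mxE.
exact: cvg_coord.
Qed.

Lemma has_deriv_from_mx (R : realType) (m n : nat) (a t : R)
    (f : R -> 'M[R]_(m, n)) (f' : 'M[R]_(m, n)) :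
  (forall i j, has_deriv_from a (fun s => f s i j : R^o) t (f' i j)) ->
  has_deriv_from a f t f'.
Proof.
move=> ff; apply: cvg_mx => i j.
have := ff i j; rewrite /has_deriv_from.
suff -> : diffq (fun s => f s i j : R^o) t = fun s => diffq f t s i j by [].
by apply/funext => s; rewrite !mxE.
Qed.

Lemma is_derive1B (R : realType) (f g : R -> R) (x df dg : R) :
  is_derive x 1 f df -> is_derive x 1 g dg ->
  is_derive x 1 (fun t => f t - g t) (df - dg).
Proof. by move=> hf hg; exact: (is_deriveB hf hg). Qed.

Lemma is_derive1N (R : realType) (f : R -> R) (x df : R) :
  is_derive x 1 f df -> is_derive x 1 (fun t => - f t) (- df).
Proof. by move=> hf; exact: (is_deriveN hf). Qed.

Lemma is_derive1M (R : realType) (f g : R -> R) (x df dg : R) :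
  is_derive x 1 f df -> is_derive x 1 g dg ->
  is_derive x 1 (fun t => f t * g t) (df * g x + f x * dg).
Proof.
move=> hf hg; apply: (is_derive_eq (is_deriveM hf hg)).
by rewrite addrC /GRing.scale/= [g x * _]mulrC.
Qed.

Lemma is_derive1_expR (R : realType) (f : R -> R) (x df : R) :
  is_derive x 1 f df -> is_derive x 1 (fun t => expR (f t)) (df * expR (f x)).
Proof.
move=> hf; apply: (is_derive_eq (is_derive1_comp (is_derive_expR (f x)) hf)).
by rewrite mulrC.
Qed.

(** * Comparison of functions through their derivatives *)

Lemma nonincreasing_from (R : realType) (a b : R) (f g : R -> R) :
  a <= b -> {within `[a, +oo[, continuous f} ->
  (forall t, a < t < b -> is_derive t 1 f (g t) /\ g t <= 0) -> f b <= f a.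
Proof.
move=> ab fc fg.
apply: (@ler0_derive1_le_cc _ f a b) => //.
- by move=> x; rewrite in_itv/= => /fg[[]].
- by move=> x; rewrite in_itv/= => /fg[[_ xg] g0]; rewrite derive1E xg.
- apply: continuous_subspaceW fc => x /=; rewrite !in_itv/= andbT.
  by move=> /andP[].
- by rewrite in_itv/= lexx ab.
- by rewrite in_itv/= lexx ab.
Qed.

(** Both [f - g] and [- f - g] have nonpositive derivative and start nonpositive. This mean value
    inequality replaces estimates of integrals in the sequel. *)
Lemma le_norm_from (R : realType) (a b : R) (f g f' g' : R -> R) :
  a <= b -> `|f a| <= g a ->
  {within `[a, +oo[, continuous f} -> {within `[a, +oo[, continuous g} ->
  (forall t, a < t < b ->
    [/\ is_derive t 1 f (f' t), is_derive t 1 g (g' t) & `|f' t| <= g' t]) ->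
  `|f b| <= g b.
Proof.
move=> ab fga fc gc fg.
have key (h h' : R -> R) : h a <= g a -> {within `[a, +oo[, continuous h} ->
    (forall t, a < t < b -> is_derive t 1 h (h' t) /\ h' t <= g' t) ->
    h b <= g b.
  move=> hga hc hg; rewrite -subr_le0.
  apply: (@le_trans _ _ (h a - g a)); last by rewrite subr_le0.
  apply: (@nonincreasing_from R a b (fun t => h t - g t) (fun t => h' t - g' t)) => //.
    by move=> x; apply: cvgB; [exact: hc|exact: gc].
  move=> t tab; have [[dh hg'] [_ dg _]] := (hg t tab, fg t tab); split.
    exact: is_derive1B dh dg.
  by rewrite subr_le0.
rewrite ler_norml; apply/andP; split.
  rewrite lerNl; apply: (key (fun t => - f t) (fun t => - f' t)).
  - by rewrite (le_trans _ fga)// -normrN ler_norm.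
  - by move=> x; apply: cvgN; exact: fc.
  - move=> t tab; have [df dg le] := fg t tab; split; first exact: is_derive1N df.
    by rewrite (le_trans _ le)// -normrN ler_norm.
apply: (key f f') => //.
- by rewrite (le_trans _ fga)// ler_norm.
- move=> t tab; have [df dg le] := fg t tab; split => //.
  by rewrite (le_trans _ le)// ler_norm.
Qed.

(** * Primitives *)

Lemma integrable_from (R : realType) (a b : R) (d : R -> R) :
  {within `[a, +oo[, continuous d} ->
  lebesgue_measure.-integrable `[a, b] (EFin \o d).
Proof.
move=> dc; apply: continuous_compact_integrable; first exact: segment_compact.
apply: continuous_subspaceW dc => x /=; rewrite !in_itv/= andbT.
by case/andP.
Qed.

Lemma integral_from_point (R : realType) (a : R) (d : R -> R) :
  integral_from a a d = 0.
Proof. by rewrite /integral_from set_itv1 Rintegral_set1. Qed.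

Lemma is_derive_integral_from (R : realType) (a t : R) (d : R -> R) :
  {within `[a, +oo[, continuous d} -> a < t ->
  is_derive t 1 (fun s => integral_from a s d) (d t).
Proof.
move=> dc at_.
have dt : {for t, continuous d}.
  have /continuous_within_itvcyP[dc' _] := dc.
  by apply: dc'; rewrite in_itv/= at_.
have t1 : t < t + 1 by rewrite ltrDl.
have [df dfE] := continuous_FTC1_closed t1 (integrable_from (t + 1) dc) at_ dt.
by split; rewrite -?derive1E.
Qed.

Lemma continuous_integral_from (R : realType) (a : R) (d : R -> R) :
  {within `[a, +oo[, continuous d} ->
  {within `[a, +oo[, continuous (fun s => integral_from a s d)}.
Proof.
move=> dc; apply/continuous_within_itvcyP; split=> [t|].
  rewrite in_itv/= andbT => at_.
  have [df _] := is_derive_integral_from dc at_.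
  exact/differentiable_continuous/derivable1_diffP.
have a1 : a < a + 1 by rewrite ltrDl.
have := parameterized_integral_continuous (ltW a1) (integrable_from (a + 1) dc).
by move/(continuous_within_itvP _ a1) => [].
Qed.

(** The difference of the two sides starts at 0 and has zero derivative, so the mean value
    inequality with majorant 0 applies. *)
Lemma integral_from_eq (R : realType) (a t : R) (d G : R -> R) :
  {within `[a, +oo[, continuous d} -> {within `[a, +oo[, continuous G} ->
  (forall s, a < s -> is_derive s 1 G (d s)) -> G a = 0 -> a <= t ->
  integral_from a t d = G t.
Proof.
move=> dc Gc Gd Ga at_; apply/eqP; rewrite -subr_eq0 -normr_le0.
apply: (@le_norm_from R a t (fun s => integral_from a s d - G s) (cst 0)
  (fun s => d s - d s) (cst 0)) => //.
- by rewrite integral_from_point Ga subrr normr0.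
- by move=> x; apply: cvgB; [exact: continuous_integral_from|exact: Gc].
- by move=> x; exact: cvg_cst.
move=> s /andP[as_ _]; split.
- exact: is_derive1B (is_derive_integral_from dc as_) (Gd s as_).
- exact: is_derive_cst.
- by rewrite subrr normr0.
Qed.

Definition prim (R : realType) (a : R) (f : R -> R) (t : R) : R :=
  integral_from (a - 1) t f - integral_from (a - 1) a f.

Lemma prim_start (R : realType) (a : R) (f : R -> R) : prim a f a = 0.
Proof. exact: subrr. Qed.

(* Integrating from [a - 1] makes the primitive two-sidedly differentiable
   at [a]. *)
Lemma is_derive_prim (R : realType) (a t : R) (f : R -> R) :
  continuous f -> a <= t -> is_derive t 1 (prim a f) (f t).
Proof.
move=> fc at_; rewrite -[f t]subr0.
have fc' : {within `[a - 1, +oo[, continuous f} by exact: continuous_subspaceT.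
have at1 : a - 1 < t by lra.
exact: (is_derive1B (is_derive_integral_from fc' at1)
  (is_derive_cst (integral_from (a - 1) a f) t 1)).
Qed.

Lemma is_derive1_continuous (R : realType) (f : R -> R) (t df : R) :
  is_derive t 1 f df -> {for t, continuous f}.
Proof. by case=> d _; exact/differentiable_continuous/derivable1_diffP. Qed.

Lemma continuous_prim (R : realType) (a : R) (f : R -> R) :
  continuous f -> continuous (fun t => prim a f (Num.max a t)).
Proof.
move=> fc t; apply: continuous_comp; first exact: continuous_maxl.
by apply: is_derive1_continuous; apply: is_derive_prim; rewrite ?le_max ?lexx.
Qed.

(** * Global existence under a time-dependent Lipschitz bound *)

Definition vprim (R : realType) (n : nat) (a : R) (f : R -> 'cV[R]_n) (t : R) :
    'cV[R]_n :=
  \col_i prim a (fun s => f s i 0) t.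

Lemma vprim_start (R : realType) (n : nat) (a : R) (f : R -> 'cV[R]_n) :
  vprim a f a = 0.
Proof. by apply/colP => i; rewrite !mxE prim_start. Qed.

Lemma vprim_cst0 (R : realType) (n : nat) (a t : R) :
  vprim a (cst 0 : R -> 'cV[R]_n) t = 0.
Proof.
apply/colP => i; rewrite !mxE /prim /integral_from.
have -> : (fun s : R => (cst 0 s : 'cV[R]_n) i 0) = cst 0.
  by apply/funext => s; rewrite mxE.
by rewrite !Rintegral_cst// !mul0r subrr mxE.
Qed.

Lemma continuous_coord (R : realType) (T : topologicalType) (m n : nat)
    (f : T -> 'M[R]_(m, n)) i j :
  continuous f -> continuous (fun s => f s i j).
Proof. by move=> fc s; exact: cvg_coord (fc s). Qed.

Lemma is_derive_vprim (R : realType) (n : nat) (a t : R)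
    (f : R -> 'cV[R]_n) i :
  continuous f -> a <= t ->
  is_derive t 1 (fun s => vprim a f s i 0) (f t i 0).
Proof.
move=> fc at_.
have -> : (fun s => vprim a f s i 0) = prim a (fun s => f s i 0).
  by apply/funext => s; rewrite mxE.
by apply: is_derive_prim => //; exact: continuous_coord.
Qed.

Lemma has_deriv_from_vprim (R : realType) (n : nat) (a t : R)
    (f : R -> 'cV[R]_n) :
  continuous f -> a <= t -> has_deriv_from a (vprim a f) t (f t).
Proof.
move=> fc at_; apply: has_deriv_from_mx => i j; rewrite ord1.
by apply: is_derive_has_deriv_from; exact: is_derive_vprim.
Qed.

Lemma continuous_vprim (R : realType) (n : nat) (a : R)
    (f : R -> 'cV[R]_n) :
  continuous f -> continuous (fun t => vprim a f (Num.max a t)).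
Proof.
move=> fc t; apply: cvg_mx => i j; rewrite mxE.
under eq_fun do rewrite mxE.
by apply: continuous_prim; exact: continuous_coord.
Qed.

(* The weight [expR (2 * \int lam)] makes the Picard operator a contraction
   with factor 1/2 on the whole half-line. *)
Definition picard_weight (R : realType) (a : R) (lam : R -> R) (t : R) : R :=
  expR (2 * prim a lam t).

Lemma is_derive_picard_weight (R : realType) (a t : R) (lam : R -> R) :
  continuous lam -> a <= t ->
  is_derive t 1 (picard_weight a lam) (2 * lam t * picard_weight a lam t).
Proof.
move=> lamc at_; apply: is_derive1_expR.
have := is_derive1M (is_derive_cst (2 : R) t 1) (is_derive_prim lamc at_).
by rewrite mul0r add0r.
Qed.

Lemma picard_weight_ge1 (R : realType) (a t : R) (lam : R -> R) :
  continuous lam -> (forall s, a <= s -> 0 <= lam s) -> a <= t ->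
  1 <= picard_weight a lam t.
Proof.
move=> lamc lam0 at_; rewrite -expR0 ler_expR mulr_ge0//.
have := @le_norm_from R a t (cst 0) (prim a lam) (cst 0) lam at_.
rewrite /= normr0; apply => //.
- by rewrite prim_start.
- by move=> x; exact: cvg_cst.
- apply: (@continuous_from_eq _ _ _ _ _ _ (continuous_prim lamc)) => s as_.
  by rewrite max_r.
- move=> s /andP[as_ _]; split; first exact: is_derive_cst.
    by apply: is_derive_prim => //; exact: ltW.
  by rewrite lam0// ltW.
Qed.

(** The weight has derivative [2 * lam] times itself, so [c / 2] times the weight has exactly the
    assumed bound as derivative. This is where the contraction factor 1/2 arises. *)
Lemma le_picard_weight (R : realType) (n : nat) (a c : R) (lam : R -> R)
    (f h : R -> 'cV[R]_n) :
  continuous lam -> continuous f -> continuous h -> 0 <= c ->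
  (forall s, a <= s -> `|f s - h s| <= c * lam s * picard_weight a lam s) ->
  forall t, a <= t ->
    `|vprim a f t - vprim a h t| <= c / 2 * picard_weight a lam t.
Proof.
move=> lamc fc hc c0 fh t at_.
have w0 s : 0 < picard_weight a lam s by exact: expR_gt0.
have cw s : 0 <= c / 2 * picard_weight a lam s.
  by rewrite mulr_ge0 ?divr_ge0// ltW.
apply: norm_mx_le => // i j.
rewrite ord1 mxE [X in _ + X]mxE.
apply: (@le_norm_from R a t (fun s => vprim a f s i 0 - vprim a h s i 0)
  (fun s => c / 2 * picard_weight a lam s) (fun s => f s i 0 - h s i 0)
  (fun s => c * lam s * picard_weight a lam s)).
- exact: at_.
- by rewrite !vprim_start subrr normr0.
- have H k : continuous k ->
      {within `[a, +oo[, continuous (fun s => vprim a k s i 0)}.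
    move=> kc; apply: (@continuous_from_eq _ _ _ _
      (fun s => vprim a k (Num.max a s) i 0)).
      by move=> s as_; rewrite max_r.
    exact: continuous_coord (continuous_vprim kc).
  by move=> x; apply: cvgB; exact: H.
- apply: (@continuous_from_eq _ _ _ _
    (fun s => c / 2 * picard_weight a lam (Num.max a s))).
    by move=> s as_; rewrite max_r.
  move=> x; apply: cvgM; first exact: cvg_cst.
  apply: (@continuous_comp _ _ _ (Num.max a) (picard_weight a lam)).
    exact: continuous_maxl.
  apply: is_derive1_continuous; apply: is_derive_picard_weight => //.
  by rewrite le_max lexx.
move=> s /andP[/ltW as_ _]; split.
- exact: is_derive1B (is_derive_vprim i fc as_) (is_derive_vprim i hc as_).
- have := is_derive1M (is_derive_cst (c / 2) s 1)
    (is_derive_picard_weight lamc as_).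
  rewrite mul0r add0r /=; set x := (X in is_derive _ _ _ X).
  by rewrite (_ : x = c * lam s * picard_weight a lam s)// /x; field.
- rewrite (le_trans _ (fh s as_))// (le_trans _ (le_coord_norm _ i 0))//.
  by rewrite !mxE.
Qed.

Lemma half_expr_small (R : realType) (c eps : R) :
  0 < eps -> exists k, 2 * 2^-1 ^+ k * c < eps.
Proof.
move=> eps0; have : (2 * 2^-1 ^+ k * c : R) @[k --> \oo] --> 2 * 0 * c.
  apply: cvgM; last exact: cvg_cst.
  apply: cvgM; first exact: cvg_cst.
  by apply: cvg_expr; rewrite ger0_norm ?invr_ge0// invf_lt1 ?ltr1n.
rewrite mulr0 mul0r => /cvgrPdist_lt /(_ _ eps0)[N _ /(_ N (leqnn _))] /=.
rewrite sub0r normrN => h; exists N; exact: le_lt_trans (ler_norm _) h.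
Qed.

(** Increments telescope to a Cauchy bound at each time, and completeness gives the limit.
    Continuity is an argument with three terms below [eps / 3]: near [t] the weight stays below its
    value plus 1, so one index [k] serves a whole neighborhood. *)
Lemma geometric_limit (R : realType) (n : nat) (a : R)
    (z : nat -> R -> 'cV[R]_n) (e : R -> R) :
  (forall t, 0 < e t) -> continuous (fun t => e (Num.max a t)) ->
  (forall k, continuous (fun t => z k (Num.max a t))) ->
  (forall k t, a <= t -> `|z k.+1 t - z k t| <= 2^-1 ^+ k * e t) ->
  exists2 y : R -> 'cV[R]_n, continuous y &
    forall k t, a <= t -> `|y t - z k t| <= 2 * 2^-1 ^+ k * e t.
Proof.
move=> e0 ec zc dz.
have zz k p t : a <= t ->
    `|z (p + k)%N t - z k t| <= (2 * 2^-1 ^+ k - 2 * 2^-1 ^+ (p + k)) * e t.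
  move=> at_; elim: p => [|p ih]; first by rewrite !subrr normr0 mul0r.
  rewrite addSn -(subrKA (z (p + k)%N t)) (le_trans (ler_normD _ _))//.
  rewrite (le_trans (lerD (dz _ _ at_) ih))// -mulrDl (ler_wpM2r (ltW (e0 _)))//.
  by rewrite exprS; lra.
have zk k p t : a <= t -> (k <= p)%N ->
    `|z p t - z k t| <= 2 * 2^-1 ^+ k * e t.
  move=> at_ kp; rewrite -(subnK kp) (le_trans (zz _ _ _ at_))//.
  by rewrite (ler_wpM2r (ltW (e0 _)))// gerBl mulr_ge0 ?exprn_ge0.
pose y t : 'cV[R]_n := lim (z k (Num.max a t) @[k --> \oo]).
have ycvg t : z k (Num.max a t) @[k --> \oo] --> y t.
  apply/cvg_ex => /=; apply/cvg_ex; apply/cauchy_cvgP; apply: cauchy_exP => eps eps0.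
  have [k kP] := half_expr_small (e (Num.max a t)) eps0.
  exists (z k (Num.max a t)); exists k => // p /= kp.
  rewrite -ball_normE /= distrC (le_lt_trans _ kP)//.
  by apply: zk => //; rewrite le_max lexx.
have yz k t : `|y t - z k (Num.max a t)| <= 2 * 2^-1 ^+ k * e (Num.max a t).
  have amt : a <= Num.max a t by rewrite le_max lexx.
  have : `|z p (Num.max a t) - z k (Num.max a t)| @[p --> \oo] -->
      `|y t - z k (Num.max a t)|.
    by apply: cvg_norm; apply: cvgB => //; exact: cvg_cst.
  move=> H; rewrite -(cvg_lim (@Rhausdorff R) H).
  apply: limr_le; first exact: cvgP H.
  by exists k => // p /= kp; exact: zk.
exists y; last by move=> k t at_; have := yz k t; rewrite max_r.
move=> t; apply/cvgrPdist_lt => eps eps0.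
have [k kP] := half_expr_small (e (Num.max a t) + 1)
  (divr_gt0 eps0 (ltr0n _ 3)).
have := ec t => /cvgrPdist_lt /(_ 1 ltr01) ec1.
have /cvgrPdist_lt /(_ _ (divr_gt0 eps0 (ltr0n _ 3))) zc1 := zc k t.
near=> s.
have es : e (Num.max a s) <= e (Num.max a t) + 1.
  have : `|e (Num.max a t) - e (Num.max a s)| < 1 by near: s.
  by move=> h; have := ler_norm (- (e (Num.max a t) - e (Num.max a s)));
    rewrite normrN; lra.
have zs : `|z k (Num.max a t) - z k (Num.max a s)| < eps / 3 by near: s.
have yt := yz k t; have ys := yz k s.
have h1 : 2 * 2^-1 ^+ k * e (Num.max a t) < eps / 3.
  by apply: le_lt_trans kP; rewrite ler_wpM2l ?mulr_ge0 ?exprn_ge0// lerDl.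
have h2 : 2 * 2^-1 ^+ k * e (Num.max a s) < eps / 3.
  by apply: le_lt_trans kP; rewrite ler_wpM2l ?mulr_ge0 ?exprn_ge0.
rewrite -(subrKA (z k (Num.max a t))) -(subrKA (z k (Num.max a s)) (z k (Num.max a t))).
rewrite (le_lt_trans (ler_normD _ _))//.
have := ler_normD (z k (Num.max a t) - z k (Num.max a s)) (z k (Num.max a s) - y s).
by rewrite [`|_ - y s|]distrC; lra.
Unshelve. all: by end_near. Qed.

(** Picard iteration from 0 contracts in the norm weighted by [picard_weight], so its limit solves
    the equation on the whole half-line without continuation of local solutions. Continuity of [g]
    is needed only along continuous curves. *)
Lemma picard (R : realType) (n : nat) (a : R) (g : R -> 'cV[R]_n -> 'cV[R]_n)
    (lam : R -> R) :
  (forall z, continuous z -> continuous (fun t => g t (z t))) ->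
  continuous lam ->
  (forall t z1 z2, a <= t -> `|g t z1 - g t z2| <= lam t * `|z1 - z2|) ->
  (forall t, a <= t -> `|g t 0| <= lam t) ->
  exists z, solution g a 0 z.
Proof.
move=> gc lamc glip g0.
pose step (y : R -> 'cV[R]_n) := vprim a (fun t => g t (y (Num.max a t))).
pose z k := iter k step (cst 0).
pose e := picard_weight a lam.
have e0 t : 0 < e t by exact: expR_gt0.
have zc k : continuous (fun t => z k (Num.max a t)).
  elim: k => [|k ih]; first by move=> x; exact: cvg_cst.
  exact: (continuous_vprim (gc _ ih)).
have lam0 s : a <= s -> 0 <= lam s by move=> as_; exact: le_trans (g0 s as_).
(* The first increment is bounded since [g t 0] is at most [lam t], hence at most [lam t] times a
   weight that is at least 1. *)
have dz k t : a <= t -> `|z k.+1 t - z k t| <= 2^-1 ^+ k * e t.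
  elim: k t => [|k ih] t at_.
    have gc0 : continuous (fun t => g t ((cst 0 : R -> 'cV[R]_n) t)).
      by apply: gc => x; exact: cvg_cst.
    have cc0 : continuous (cst (0 : 'cV[R]_n) : R -> 'cV[R]_n).
      by move=> x; exact: cvg_cst.
    have /= := @le_picard_weight R n a 1 lam _ _ lamc gc0 cc0 ler01 _ t at_.
    rewrite vprim_cst0; move=> h; rewrite expr0.
    apply: (le_trans (h _)) => [s as_|].
      rewrite subr0 mul1r (le_trans (g0 s as_))// ler_peMr ?lam0//.
      exact: picard_weight_ge1.
    by rewrite (ler_wpM2r (ltW (e0 _)))//; lra.
  rewrite exprSr.
  apply: le_picard_weight => //; first exact: gc (zc k.+1).
  - exact: gc (zc k).
  move=> s as_; rewrite (le_trans (glip _ _ _ as_))// max_r//.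
  by rewrite -mulrA mulrCA ler_wpM2l ?lam0 ?ih.
have ec : continuous (fun t => e (Num.max a t)).
  move=> x; apply: (@continuous_comp _ _ _ (Num.max a) e).
    exact: continuous_maxl.
  apply: is_derive1_continuous; apply: is_derive_picard_weight => //.
  by rewrite le_max lexx.
have [y yc yz] := geometric_limit e0 ec zc dz.
pose w := vprim a (fun t => g t (y t)).
(* The limit is a fixed point: its image and the limit itself are each within [2^-1 ^+ k * e t] of
   iterate [k.+1], for every [k]. *)
have wy t : a <= t -> w t = y t.
  move=> at_; apply/eqP; rewrite -subr_eq0 -normr_le0.
  rewrite leNgt; apply/negP => wy0.
  have [k] := half_expr_small (e t) wy0; rewrite ltNge => /negP; apply.
  rewrite -(subrKA (z k.+1 t)) (le_trans (ler_normD _ _))//.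
  have h1 : `|w t - z k.+1 t| <= 2 * 2^-1 ^+ k / 2 * e t.
    apply: le_picard_weight => //; first exact: gc yc.
    - exact: gc (zc k).
    move=> s as_; rewrite (le_trans (glip _ _ _ as_))//.
    rewrite [leRHS](_ : _ = lam s * (2 * 2^-1 ^+ k * e s)); last by rewrite /e; ring.
    by rewrite max_r//; exact: ler_wpM2l (lam0 _ as_) _ _ (yz k s as_).
  have h2 := yz k.+1 t at_; rewrite distrC in h2.
  rewrite (le_trans (lerD h1 h2))// exprS -mulrDl (ler_wpM2r (ltW (e0 _)))//; lra.
exists w; split=> [|t at_]; first exact: vprim_start.
by rewrite wy//; apply: has_deriv_from_vprim => //; exact: gc yc.
Qed.

(** * Smooth majorants with bounded look-ahead *)

(** An infinite sum of shifted ramps, cut where the terms vanish: if [p] is zero on nonpositive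
    arguments, all terms with [j >= u] are zero. *)
Definition ramp_sum (R : realType) (w : nat -> R) (p : R -> R) (u : R) : R :=
  \sum_(j < (Num.truncn u).+1) w j * p (u - j%:R).

Lemma ramp_sum_eq (R : realType) (w : nat -> R) (p : R -> R) (u : R) (N : nat) :
  (forall v, v <= 0 -> p v = 0) -> u <= N%:R ->
  ramp_sum w p u = \sum_(j < N) w j * p (u - j%:R).
Proof.
move=> p0 uN.
have widen K L : (K <= L)%N -> u <= K%:R ->
    \sum_(j < L) w j * p (u - j%:R) = \sum_(j < K) w j * p (u - j%:R).
  move=> KL uK; rewrite -(subnKC KL) big_split_ord /= [X in _ + X]big1 ?addr0//.
  move=> i _; rewrite p0 ?mulr0// subr_le0 (le_trans uK)// ler_nat.
  exact: leq_addr.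
have uT := ltW (truncnS_gt u).
by have [NT|/ltnW TN] := leqP (Num.truncn u).+1 N; [rewrite (widen _ _ NT)|
  rewrite /ramp_sum (widen _ _ TN)].
Qed.

(** The number of terms jumps at integers, but the extra terms vanish, so near [u] a fixed finite
    sum represents [ramp_sum]. Continuity and derivatives are then computed term by term. *)
Lemma near_ramp_sum (R : realType) (w : nat -> R) (p : R -> R) (u : R) :
  (forall v, v <= 0 -> p v = 0) ->
  \forall v \near u, \sum_(j < (Num.truncn u).+1) w j * p (v - j%:R) =
    ramp_sum w p v.
Proof.
move=> p0; near=> v; apply/esym/ramp_sum_eq => //; apply: ltW.
by near: v; apply: (cvgr_lt u (@cvg_id _ (nbhs u))); exact: truncnS_gt.
Unshelve. all: by end_near. Qed.

Lemma continuous_ramp_sum (R : realType) (w : nat -> R) (p : R -> R) :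
  (forall v, v <= 0 -> p v = 0) -> continuous p -> continuous (ramp_sum w p).
Proof.
move=> p0 pc u; apply: cvg_trans; first exact: near_eq_cvg (near_ramp_sum w u p0).
apply: cvg_sumr => j _; apply: cvgM; first exact: cvg_cst.
apply: (@cvg_comp _ _ _ (fun v => v - j%:R) p _ _ _ _ (pc _)).
by apply: cvgB; [exact: cvg_id|exact: cvg_cst].
Qed.

Lemma is_derive_ramp_sum (R : realType) (w : nat -> R) (p p' : R -> R) (u : R) :
  (forall v, v <= 0 -> p v = 0) -> (forall v : R, is_derive v 1 p (p' v)) ->
  is_derive u 1 (ramp_sum w p) (ramp_sum w p' u).
Proof.
move=> p0 pp'; apply: near_eq_is_derive (near_ramp_sum w u p0) _.
rewrite -[X in is_derive _ _ X _]fct_sumE; apply: is_derive_sum => j.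
have dj : is_derive u 1 (fun v : R => v - j%:R) (1 - 0).
  exact: is_derive1B (is_derive_id u 1) (is_derive_cst (j%:R : R) u 1).
have := is_derive1M (is_derive_cst (w j) u 1)
  (@is_derive1_comp R p (fun v => v - j%:R) u _ _ (pp' (u - j%:R)) dj).
by rewrite mul0r add0r subr0 mulr1.
Qed.

(** A remainder of order [h ^+ 2] makes the difference quotient err by at most [|h|]. This form
    handles the squared ramp at its kink by plain inequalities. *)
Lemma is_derive_quadratic (R : realType) (f : R -> R) (u l : R) :
  (forall h, `|f (h + u) - f u - h * l| <= h ^+ 2) -> is_derive u 1 f l.
Proof.
move=> fl.
have fl' : h^-1 *: (f (h *: 1 + u) - f u) @[h --> 0^'] --> l.
  apply/cvgrPdist_lt => e e0; exists e => //= h /=.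
  rewrite sub0r normrN => he h0; apply: le_lt_trans he.
  have h0' : 0 < `|h| by rewrite normr_gt0.
  rewrite distrC -(ler_pM2l h0') -normrM mulrBr [X in f (X + _)]mulr1.
  rewrite [X in _ * X - _]/GRing.scale /= mulrA mulfV// mul1r.
  by rewrite -normrM -expr2 ger0_norm ?sqr_ge0.
split; first by apply/cvg_ex; exists l.
by apply: cvg_lim => //; exact: norm_hausdorff.
Qed.

Lemma is_derive_sqr_ramp (R : realType) (u : R) :
  is_derive u 1 (fun v => Num.max 0 v ^+ 2) (2 * Num.max 0 u).
Proof.
apply: is_derive_quadratic => h; rewrite ler_norml !expr2.
have [u0|u0] := leP 0 u; have [hu0|hu0] := leP 0 (h + u); nra.
Qed.

(* Each [m i] is phased in by a quadratic ramp starting at [i - 1]; this keeps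
   [glue m] of class C^1 and lets it look ahead by at most one index. *)
Definition glue (R : realType) (m : nat -> R) (u : R) : R :=
  m 0%N + ramp_sum (fun j => m j.+1) (fun v => Num.max 0 v ^+ 2) u.

Lemma sqr_ramp0 (R : realType) (v : R) : v <= 0 -> Num.max 0 v ^+ 2 = 0.
Proof. by move=> v0; rewrite max_l// expr0n. Qed.

(** All terms are nonnegative. The ramp carrying [m i] starts at [i - 1], so its square is at least
    1 once [u >= i]; [m 0] is present as a constant. *)
Lemma glue_ge (R : realType) (m : nat -> R) (u : R) (i : nat) :
  (forall j, 0 <= m j) -> i%:R <= u -> m i <= glue m u.
Proof.
move=> m0 iu; rewrite /glue.
have t0 (j : nat) : 0 <= m j.+1 * Num.max 0 (u - j%:R) ^+ 2.
  by rewrite mulr_ge0 ?sqr_ge0.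
case: i iu => [|i] iu; first by rewrite lerDl sumr_ge0.
rewrite -[leLHS]add0r lerD// /ramp_sum.
have iT : (i < (Num.truncn u).+1)%N.
  rewrite -(ltr_nat R) (le_lt_trans _ (truncnS_gt u))// (le_trans _ iu)//.
  by rewrite ler_nat.
rewrite (bigD1 (Ordinal iT))//= -[leLHS]addr0 lerD ?sumr_ge0//.
rewrite ler_peMr// exprn_ege1// le_max; apply/orP; right.
by rewrite lerBrDr addrC natr1.
Qed.

(** The weight [m j.+1] counts only when [u > j], that is, when its index is below [u + 1]. *)
Lemma eq_glue (R : realType) (m m' : nat -> R) (u : R) : 0 <= u ->
  (forall i, i%:R < u + 1 -> m i = m' i) -> glue m u = glue m' u.
Proof.
move=> u0 mm'; rewrite /glue mm' ?ltr_wpDl//; congr (_ + _).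
apply: eq_bigr => j _; have [uj|ju] := leP u j%:R.
  by rewrite sqr_ramp0 ?mulr0// subr_le0.
by rewrite mm'// -natr1 ltrD2r.
Qed.

Lemma glue_C1_from (R : realType) (m : nat -> R) (a h : R) :
  C1_from a (fun t => glue m ((t - a) / h) : R^o).
Proof.
pose p' (v : R) := 2 * Num.max 0 v.
pose g t : R := ramp_sum (fun j => m j.+1) p' ((t - a) / h) / h.
have affc : continuous (fun t : R => (t - a) / h).
  move=> t; apply: cvgM; last exact: cvg_cst.
  by apply: cvgB; [exact: cvg_id|exact: cvg_cst].
apply: (@C1_from_is_derive _ _ _ _ (g : R -> R^o)) => [t _|].
  have dt : is_derive t 1 (fun t : R => (t - a) / h) (h^-1).
    have := is_derive1M (is_derive1B (is_derive_id t 1) (is_derive_cst a t 1))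
      (is_derive_cst h^-1 t 1).
    by rewrite subr0 mul1r mulr0 addr0.
  have := @is_derive1_comp R _ (fun t : R => (t - a) / h) t _ _
    (is_derive_ramp_sum (fun j => m j.+1) ((t - a) / h)
    (@sqr_ramp0 R) (@is_derive_sqr_ramp R)) dt.
  move=> H; have := is_deriveD (is_derive_cst (m 0%N) t 1) H.
  by rewrite add0r.
apply: continuous_subspaceT => t.
apply: cvgM; last exact: cvg_cst.
apply: (@continuous_comp _ _ _ (fun t : R => (t - a) / h)
  (ramp_sum (fun j => m j.+1) p')); first exact: affc.
apply: continuous_ramp_sum => [v v0|v]; first by rewrite /p' max_l// mulr0.
by apply: cvgM; [exact: cvg_cst|exact: continuous_maxl].
Qed.

(** * Bounds on compact sets *)

Lemma compact_norm_le (R : realType) (n : nat) (c : R) :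
  compact [set v : 'cV[R]_n | `|v| <= c].
Proof.
have [c0|c0] := ltP c 0.
  rewrite (_ : mkset _ = set0); first exact: compact0.
  apply/seteqP; split => // v /= vc.
  by have := le_lt_trans vc c0; rewrite normr_lt0.
(* The ball of the sup norm is the transpose of a product of segments, and Tychonoff's theorem for
   row vectors applies. *)
rewrite (_ : mkset _ =
  trmx @` [set v : 'rV[R]_n | forall i, `[- c, c]%classic (v ord0 i)]).
  apply: continuous_compact.
    by apply: continuous_subspaceT => v; exact: (@cvg_trmx _ _ _ _ (nbhs v) _ id v (@cvg_id _ (nbhs v))).
  by apply: (@rV_compact _ _ (fun=> `[- c, c]%classic)) => _;
    exact: segment_compact.
apply/seteqP; split=> [v vc|_ [v vc <-]] /=.
  exists v^T; last by rewrite trmxK.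
  by move=> i; rewrite /= mxE in_itv/= -ler_norml (le_trans (le_coord_norm _ _ _)).
apply: norm_mx_le => // i j; rewrite mxE ord1.
by have := vc i; rewrite /= in_itv/= -ler_norml.
Qed.

Lemma compact_sphere (R : realType) (n : nat) :
  compact [set v : 'cV[R]_n | enorm v = 1].
Proof.
apply: (subclosed_compact _ (@compact_norm_le R n 1)).
  rewrite (_ : mkset _ = (@enorm R n) @^-1` [set 1])//.
  apply: preimage_closed; last exact: closed_eq.
  by move=> v _; exact: (@cvg_enorm _ _ _ (nbhs v) _ id v (@cvg_id _ (nbhs v))).
by move=> v /= <-; exact: norm_le_enorm.
Qed.

Lemma compact_segment_prod (R : realType) (T : topologicalType) (a b : R)
    (K : set T) : compact K -> compact (`[a, b]%classic `*` K).
Proof. by move=> Kc; apply: compact_setX => //; exact: segment_compact. Qed.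

(** Local thresholds combine to a uniform one by the near-covering form of compactness, with
    parameter [C] tending to infinity. This works because each local statement holds for all larger
    constants. *)
Lemma compact_bound (R : realType) (X : topologicalType) (K : set X)
    (P : R -> X -> Prop) :
  compact K ->
  (forall x, K x -> exists C, \forall x' \near x, K x' ->
     forall C', C <= C' -> P C' x') ->
  exists2 C, 1 <= C & forall x, K x -> P C x.
Proof.
move=> /compact_near_coveringP/near_covering_withinP Kc KP.
have H : \forall C \near +oo, K `<=` P C.
  apply: Kc => x Kx; have [C CP] := KP x Kx.
  exists ([set x' | K x' -> forall C', C <= C' -> P C' x'], [set C' | C <= C']).
    by split => //=; apply: nbhs_pinfty_ge; exact: num_real.
  by move=> [x' C'] /= [h hC] Kx'; exact: h.
near (pinfty_nbhs R) => C; exists C; last by near: C.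
by near: C; apply: nbhs_pinfty_ge; exact: num_real.
Unshelve. all: by end_near. Qed.

Lemma cvg_pair_to (T : Type) (G : set_system T) {FG : Filter G}
    (X Y : topologicalType) (f : T -> X) (g : T -> Y) (x : X) (y : Y) :
  f @ G --> x -> g @ G --> y -> (f z, g z) @[z --> G] --> (x, y).
Proof. by move=> fx gy; exact: cvg_pair fx gy. Qed.

Lemma cvg_continuous (T : Type) (G : set_system T) (X Y : topologicalType)
    (f : T -> X) (h : X -> Y) (x : X) :
  f @ G --> x -> {for x, continuous h} -> h (f z) @[z --> G] --> h x.
Proof. by move=> fx hx; exact: (cvg_comp f h fx hx). Qed.

Lemma near_fst (X Y : topologicalType) (x : X) (y : Y) (A : set X) :
  nbhs x A -> \forall p \near (x, y), A p.1.
Proof.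
by move=> xA; exists (A, setT) => [|p []//]; split => //=; exact: filterT.
Qed.

Lemma near_snd (X Y : topologicalType) (x : X) (y : Y) (A : set Y) :
  nbhs y A -> \forall p \near (x, y), A p.2.
Proof.
by move=> yA; exists (setT, A) => [|p []//]; split => //=; exact: filterT.
Qed.

Lemma continuous_fst (X Y : topologicalType) : continuous (@fst X Y).
Proof. by move=> [x y]; exact: cvg_fst. Qed.

Lemma continuous_snd (X Y : topologicalType) : continuous (@snd X Y).
Proof. by move=> [x y]; exact: cvg_snd. Qed.

Lemma continuous_max_fst (R : realType) (X Y U : topologicalType)
    (f : R -> X -> Y -> U) (a : R) :
  {within [set p : R * X * Y | a <= p.1.1],
    continuous (fun p : R * X * Y => f p.1.1 p.1.2 p.2)} ->
  continuous (fun p : R * X * Y => f (Num.max a p.1.1) p.1.2 p.2).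
Proof.
move=> fc.
apply: (within_continuous_comp (g := fun p => (Num.max a p.1.1, p.1.2, p.2)) fc).
  move=> p; apply: cvg_pair_to; last exact: cvg_snd.
  have p1 : q.1 @[q --> p] --> p.1 by exact: cvg_fst.
  apply: cvg_pair_to; last exact: cvg_continuous p1 (@continuous_snd _ _ _).
  have p11 := cvg_continuous p1 (@continuous_fst _ _ p.1).
  exact: cvg_continuous p11 (@continuous_maxl _ _ _).
by move=> p; rewrite /= le_max lexx.
Qed.

(** Local Lipschitz continuity becomes uniform on a compact set of triples [(t, e1, e2)]. Near the
    diagonal the local constant serves; off it the distance of [e1] and [e2] stays away from 0 and
    the continuous numerator is bounded. *)
Lemma lipschitz_bound (R : realType) (n k : nat)
    (F : R -> 'cV[R]_n -> 'cV[R]_k -> 'cV[R]_n)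
    (x : R -> 'cV[R]_n) (y : R -> 'cV[R]_k) (a b xi : R) :
  {within [set p : R * 'cV[R]_n * 'cV[R]_k | 0 <= p.1.1],
    continuous (fun p : R * 'cV[R]_n * 'cV[R]_k => F p.1.1 p.1.2 p.2)} ->
  loc_lipschitz F -> continuous x -> continuous y -> 0 <= a ->
  exists2 C, 1 <= C & forall t e1 e2, a <= t <= b -> `|e1| <= xi -> `|e2| <= xi ->
    `|F t (x t - e1) (y t) - F t (x t - e2) (y t)| <= C * `|e1 - e2|.
Proof.
move=> Fc Fl xc yc a0.
pose B := [set v : 'cV[R]_n | `|v| <= xi].
have Bc : compact B by exact: compact_norm_le.
pose F0 (p : R * ('cV[R]_n * 'cV[R]_n)) (e : 'cV[R]_n) :=
  F (Num.max 0 p.1) (x p.1 - e) (y p.1).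
pose P C (p : R * ('cV[R]_n * 'cV[R]_n)) :=
  `|F0 p p.2.1 - F0 p p.2.2| <= C * `|p.2.1 - p.2.2|.
have F0c (pr : 'cV[R]_n * 'cV[R]_n -> 'cV[R]_n) : continuous pr ->
    continuous (fun p => F0 p (pr p.2)).
  move=> prc p.
  suff h : (q.1, x q.1 - pr q.2, y q.1) @[q --> p] -->
      (p.1, x p.1 - pr p.2, y p.1).
    exact: (cvg_continuous h (continuous_max_fst Fc (x := _))).
  have p1 : q.1 @[q --> p] --> p.1 by exact: cvg_fst.
  apply: cvg_pair_to; last exact: cvg_continuous p1 (yc p.1).
  apply: cvg_pair_to => //; apply: cvgB; first exact: cvg_continuous p1 (xc p.1).
  have p2 : q.2 @[q --> p] --> p.2 by exact: cvg_snd.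
  exact: cvg_continuous p2 (prc p.2).
have [[t [e1 e2]]|C C1 CP] := compact_bound
    (compact_segment_prod (a := a) (b := b) (compact_setX Bc Bc)) (P := P).
  move=> [/=]; rewrite in_itv/= => /andP[at_ tb] [B1 B2].
  have t0 : 0 <= t := le_trans a0 at_.
  have [<-|e12] := eqVneq e1 e2.
    have [r [C [r0 FC]]] := Fl t (x t - e1) (y t) t0.
    (* The factor [n] converts the Euclidean norm into the sup norm, and the absolute value covers a
       negative local constant. *)
    exists (`|C| * n%:R).
    have n1 : \forall p \near (t, (e1, e1)), `|t - p.1| < r.
      have nt : \forall s \near t, `|t - s| < r.
        exact: cvgr_dist_lt (@cvg_id _ (nbhs t)) _ r0.
      by refine (near_fst (e1, e1) nt).
    have px (pr : 'cV[R]_n * 'cV[R]_n -> 'cV[R]_n) : continuous pr ->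
        pr (e1, e1) = e1 ->
        \forall p \near (t, (e1, e1)), enorm (x p.1 - pr p.2 - (x t - e1)) < r.
      move=> prc pre.
      have : enorm (x p.1 - pr p.2 - (x t - e1)) @[p --> (t, (e1, e1))] -->
          enorm (x t - pr (e1, e1) - (x t - e1)).
        apply: cvg_enorm; apply: cvgB; last exact: cvg_cst.
        have p1 : q.1 @[q --> (t, (e1, e1))] --> t by exact: cvg_fst.
        apply: cvgB; first exact: cvg_continuous p1 (xc t).
        have p2 : q.2 @[q --> (t, (e1, e1))] --> (e1, e1) by exact: cvg_snd.
        exact: cvg_continuous p2 (prc _).
      by rewrite pre subrr enorm0 => h; exact: (cvgr_lt _ h).
    have n2 := px _ (@continuous_fst _ _) erefl.
    have n3 := px _ (@continuous_snd _ _) erefl.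
    have n4 : \forall p \near (t, (e1, e1)), enorm (y p.1 - y t) < r.
      have : enorm (y p.1 - y t) @[p --> (t, (e1, e1))] --> enorm (y t - y t).
        apply: cvg_enorm; apply: cvgB; last exact: cvg_cst.
        have p1 : q.1 @[q --> (t, (e1, e1))] --> t by exact: cvg_fst.
        exact: cvg_continuous p1 (yc t).
      by rewrite subrr enorm0 => h; exact: (cvgr_lt _ h).
    near=> p => -[/= pab _] C' CC'.
    have p0 : 0 <= p.1.
      by move: pab; rewrite in_itv/= => /andP[ap _]; exact: le_trans ap.
    rewrite /P /F0 max_r// (le_trans (norm_le_enorm _))//.
    apply: (@le_trans _ _ (C * (enorm (x p.1 - p.2.1 - (x p.1 - p.2.2)) +
        enorm (y p.1 - y p.1)))).
      apply: FC => //; by [near: p; exact: n2|near: p; exact: n3|near: p; exact: n4|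
        rewrite distrC; near: p; exact: n1].
    have -> : x p.1 - p.2.1 - (x p.1 - p.2.2) = p.2.2 - p.2.1.
      by rewrite opprB addrC addrA subrK.
    rewrite subrr enorm0 addr0.
    apply: (@le_trans _ _ (`|C| * enorm (p.2.2 - p.2.1))).
      by rewrite ler_wpM2r ?enorm_ge0 ?ler_norm.
    apply: (@le_trans _ _ (`|C| * (n%:R * `|p.2.1 - p.2.2|))).
      by rewrite ler_wpM2l// distrC enorm_le_norm.
    by rewrite mulrA ler_wpM2r.
  have D0 : 0 < `|e1 - e2| by rewrite normr_gt0 subr_eq0.
  pose D (p : R * ('cV[R]_n * 'cV[R]_n)) := `|F0 p p.2.1 - F0 p p.2.2|.
  (* Close to the point, the numerator is below its value plus 1 and the denominator above half its
     value. *)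
  exists ((D (t, (e1, e2)) + 1) / (`|e1 - e2| / 2)).
  have n1 : \forall p \near (t, (e1, e2)), D p < D (t, (e1, e2)) + 1.
    have h : D p @[p --> (t, (e1, e2))] --> D (t, (e1, e2)).
      apply: cvg_norm; apply: cvgB.
        exact: (F0c _ (@continuous_fst _ _) (t, (e1, e2))).
      exact: (F0c _ (@continuous_snd _ _) (t, (e1, e2))).
    by apply: (cvgr_lt _ h); rewrite ltrDl.
  have n2 : \forall p \near (t, (e1, e2)), `|e1 - e2| / 2 < `|p.2.1 - p.2.2|.
    have h : `|p.2.1 - p.2.2| @[p --> (t, (e1, e2))] --> `|e1 - e2|.
      have p2 : q.2 @[q --> (t, (e1, e2))] --> (e1, e2) by exact: cvg_snd.
      apply: cvg_norm; apply: cvgB.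
        exact: cvg_continuous p2 (@continuous_fst _ _ _).
      exact: cvg_continuous p2 (@continuous_snd _ _ _).
    by apply: (cvgr_gt _ h); lra.
  near=> p => _ C' CC'; rewrite /P -/(D p).
  have h1 : D p < D (t, (e1, e2)) + 1 by near: p; exact: n1.
  have h2 : `|e1 - e2| / 2 < `|p.2.1 - p.2.2| by near: p; exact: n2.
  have C0 : 0 <= C'.
    by apply: le_trans CC'; rewrite divr_ge0 ?divr_ge0 ?addr_ge0 ?normr_ge0.
  rewrite ler_pdivrMr in CC'; last by rewrite divr_gt0.
  rewrite (le_trans (ltW h1))// (le_trans CC')// (ler_wpM2l C0)//.
  exact: ltW.
exists C => // t e1 e2 /andP[at_ tb] he1 he2.
have /= := CP (t, (e1, e2)); rewrite /P/F0/= max_r ?(le_trans a0)//; apply.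
by rewrite /= in_itv/= at_ tb.
Unshelve. all: by end_near. Qed.

(** * Finsler's lemma, uniform in time *)

Lemma homo_ltn_ge (s : nat -> nat) :
  {homo s : i j / (i < j)%N} -> forall i, (i <= s i)%N.
Proof.
move=> sh; elim=> // i ih.
exact: leq_ltn_trans ih (sh _ _ (ltnSn i)).
Qed.

(* Finsler's lemma, uniformly over a compact time interval: the Compactness
   Property yields, from hypothetical violations with ever larger penalties,
   a vector of the kernel of [H t] violating the strict inequality. *)
Lemma finsler_bound (R : realType) (n k l : nat)
    (H : R -> 'M[R]_(k, n)) (Q : R -> set 'cV[R]_l)
    (psi : R -> 'cV[R]_l -> 'cV[R]_n -> R) (t0 a b : R) :
  continuous H ->
  continuous (fun p : R * 'cV[R]_l * 'cV[R]_n => psi p.1.1 p.1.2 p.2) ->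
  (forall t q c e, psi t q (c *: e) = c ^+ 2 * psi t q e) ->
  CP t0 Q -> t0 <= a ->
  (forall t e q, a <= t -> e != 0 -> H t *m e = 0 -> Q t q -> psi t q e < 0) ->
  exists2 m, 1 <= m & forall t e q, a <= t <= b -> Q t q ->
    psi t q e <= m * enorm (H t *m e) ^+ 2.
Proof.
move=> Hc psic psiZ Qcp t0a neg.
pose P C (p : R * 'cV[R]_n) := forall q, Q p.1 q ->
  psi p.1 q p.2 <= C * enorm (H p.1 *m p.2) ^+ 2.
have [[t e]|C C1 CP] := compact_bound
    (compact_segment_prod (a := a) (b := b) (@compact_sphere R n)) (P := P).
  move=> [/=]; rewrite in_itv/= => /andP[at_ tb] e1; apply: contrapT => nP.
  (* If no constant works near [(t, e)], there are violations within [1 / (i + 1)] of it with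
     penalty at least [i]. *)
  have ex (i : nat) : exists w : R * 'cV[R]_n * R * 'cV[R]_l,
      [/\ `|t - w.1.1.1| < i.+1%:R^-1, `|e - w.1.1.2| < i.+1%:R^-1,
          a <= w.1.1.1 /\ i%:R <= w.1.2, Q w.1.1.1 w.2 &
          w.1.2 * enorm (H w.1.1.1 *m w.1.1.2) ^+ 2 < psi w.1.1.1 w.2 w.1.1.2].
    apply: contrapT => nw; apply: nP; exists i%:R.
    have i0 : 0 < i.+1%:R^-1 :> R by rewrite invr_gt0.
    have nt : \forall s \near t, `|t - s| < i.+1%:R^-1.
      exact: cvgr_dist_lt (@cvg_id _ (nbhs t)) _ i0.
    have ne : \forall s \near e, `|e - s| < i.+1%:R^-1.
      exact: cvgr_dist_lt (@cvg_id _ (nbhs e)) _ i0.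
    near=> p => -[/= pab p1] C' iC' q Qq; rewrite leNgt; apply/negP => lt_psi.
    apply: nw; exists (p.1, p.2, C', q); split => //=.
    - by near: p; exact: (near_fst e nt).
    - by near: p; exact: (near_snd t ne).
    by move: pab; rewrite in_itv/= => /andP[->].
  have [w wP] := choice ex.
  have small : (i.+1%:R^-1 : R) @[i --> \oo] --> 0 by exact: cvg_harmonic.
  have tw : (w i).1.1.1 @[i --> \oo] --> t.
    apply/cvgrPdist_lt => eps eps0.
    have /cvgrPdist_lt /(_ _ eps0) := small; apply: filterS => i.
    rewrite sub0r normrN ger0_norm ?invr_ge0// => ilt.
    by have [+ _ _ _ _] := wP i => /lt_trans; apply.
  have ew : (w i).1.1.2 @[i --> \oo] --> e.
    apply/cvgrPdist_lt => eps eps0.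
    have /cvgrPdist_lt /(_ _ eps0) := small; apply: filterS => i.
    rewrite sub0r normrN ger0_norm ?invr_ge0// => ilt.
    by have [_ + _ _ _] := wP i => /lt_trans; apply.
  have [| |//|i|s [q0 [sh Qq0 qs]]] := Qcp (fun i => (w i).1.1.1) t (fun i => (w i).2).
  - by move=> i; have [_ _ [aw _] _ _] := wP i; exact: le_trans aw.
  - exact: le_trans at_.
  - by have [] := wP i.
  have soo : s @ \oo --> \oo.
    move=> A [N _ NA]; exists N => // i /= Ni; apply: NA => /=.
    exact: leq_trans Ni (homo_ltn_ge sh i).
  have psis : psi (w (s i)).1.1.1 (w (s i)).2 (w (s i)).1.1.2 @[i --> \oo] -->
      psi t q0 e.
    have : ((w (s i)).1.1.1, (w (s i)).2, (w (s i)).1.1.2) @[i --> \oo] -->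
        (t, q0, e).
      apply: cvg_pair_to; last exact: cvg_comp _ _ soo ew.
      by apply: cvg_pair_to => //; exact: cvg_comp _ _ soo tw.
    by move=> h; exact: (cvg_continuous h (psic (t, q0, e))).
  have hs : enorm (H (w (s i)).1.1.1 *m (w (s i)).1.1.2) ^+ 2 @[i --> \oo] -->
      enorm (H t *m e) ^+ 2.
    rewrite expr2; under eq_fun do rewrite expr2.
    have hs : enorm (H (w (s i)).1.1.1 *m (w (s i)).1.1.2) @[i --> \oo] -->
        enorm (H t *m e).
      apply: cvg_enorm; apply: cvg_mulmx; last exact: cvg_comp _ _ soo ew.
      exact: (cvg_continuous (cvg_comp _ _ soo tw) (Hc t)).
    exact: cvgM.
  have wi i : i%:R * enorm (H (w (s i)).1.1.1 *m (w (s i)).1.1.2) ^+ 2 <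
      psi (w (s i)).1.1.1 (w (s i)).2 (w (s i)).1.1.2.
    have [_ _ [_ Ci] _] := wP (s i); apply: le_lt_trans.
    rewrite ler_wpM2r ?sqr_ge0// (le_trans _ Ci)// ler_nat.
    exact: homo_ltn_ge.
  (* On the kernel the limit of [psi] is negative although every violation makes it positive. Off
     the kernel [psi] stays bounded along the subsequence while the penalty term grows without
     bound. *)
  have [He0|He0] := eqVneq (H t *m e) 0.
    have en0 : e != 0.
      by apply/eqP => ee; move: e1; rewrite ee enorm0 => /eqP; rewrite eq_sym oner_eq0.
    have psi0 := neg _ _ _ at_ en0 He0 Qq0.
    have : \forall i \near \oo,
        psi (w (s i)).1.1.1 (w (s i)).2 (w (s i)).1.1.2 < 0.
      exact: (cvgr_lt _ psis).
    move=> /filter_ex[i].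
    apply/negP; rewrite -leNgt; apply/ltW; apply: le_lt_trans (wi i).
    by rewrite mulr_ge0// sqr_ge0.
  have c0 : 0 < enorm (H t *m e) ^+ 2.
    rewrite exprn_gt0// lt_def enorm_ge0 andbT.
    by apply: contra_neq He0; exact: enorm_eq0.
  set c := enorm (H t *m e) ^+ 2 in c0 hs.
  have n1 : \forall i \near \oo,
      psi (w (s i)).1.1.1 (w (s i)).2 (w (s i)).1.1.2 < `|psi t q0 e| + 1.
    by apply: (cvgr_lt _ psis); have := ler_norm (psi t q0 e); lra.
  have c2 : c / 2 < c by lra.
  have n2 : \forall i \near \oo,
      c / 2 < enorm (H (w (s i)).1.1.1 *m (w (s i)).1.1.2) ^+ 2.
    exact: (cvgr_gt _ hs).
  have n3 : \forall i \near \oo, (`|psi t q0 e| + 1) / (c / 2) <= i%:R :> R.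
    exact: nbhs_infty_ger.
  have /filter_ex[i [h1 h2 h3]] : \forall i \near \oo,
    [/\ psi (w (s i)).1.1.1 (w (s i)).2 (w (s i)).1.1.2 < `|psi t q0 e| + 1,
      c / 2 < enorm (H (w (s i)).1.1.1 *m (w (s i)).1.1.2) ^+ 2 &
      (`|psi t q0 e| + 1) / (c / 2) <= i%:R].
    by near=> i; split; near: i.
  have := wi i; apply/negP; rewrite -leNgt (le_trans (ltW h1))//.
  rewrite ler_pdivrMr in h3; last by rewrite divr_gt0.
  by rewrite (le_trans h3)// ler_wpM2l// ltW.
exists C => // t e q tab Qq.
have [->|e0] := eqVneq e 0.
  by rewrite -(scale0r 0) psiZ expr0n mul0r -scalemxAr enormZ normr0 mul0r
    expr0n mulr0.
have en0 : enorm e != 0 by apply: contra_neq e0; exact: enorm_eq0.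
have enp : 0 < enorm e by rewrite lt_def en0 enorm_ge0.
(* Both sides are homogeneous of degree 2, so the bound on the unit sphere extends to every nonzero
   vector. *)
have Kp : (`[a, b]%classic `*` [set v : 'cV[R]_n | enorm v = 1])
    (t, (enorm e)^-1 *: e).
  split => /=; first by rewrite in_itv.
  by rewrite enormZ ger0_norm ?invr_ge0 ?enorm_ge0// mulVf.
have := CP _ Kp q Qq; rewrite /= psiZ -scalemxAr enormZ exprMn.
by rewrite real_normK ?num_real// mulrCA ler_pM2l ?exprn_gt0 ?invr_gt0.
Unshelve. all: by end_near. Qed.

(** * The observer *)

Definition observer (R : realType) (n k : nat)
    (F : R -> 'cV[R]_n -> 'cV[R]_k -> 'cV[R]_n) (H : R -> 'M[R]_(k, n))
    (P : R -> 'M[R]_n) (phi : R -> R) (t : R) (z : 'cV[R]_n) (w : 'cV[R]_k) :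
    'cV[R]_n :=
  F t z w + phi t *: (invmx (P t) *m (H t)^T *m (w - H t *m z)).

(** The factor [invmx P] in the gain cancels [P] in the Lyapunov derivative, so output injection
    contributes precisely the penalty on [H *m e]. *)
Lemma error_derivative_form (R : realType) (n k : nat) (P A : 'M[R]_n)
    (H : 'M[R]_(k, n)) (phi : R) (e : 'cV[R]_n) :
  P \in unitmx ->
  (e^T *m P *m (A *m e - phi *: (invmx P *m H^T *m (H *m e)))) 0 0 =
  qform (P *m A) e - phi * enorm (H *m e) ^+ 2.
Proof.
move=> uP; rewrite mulmxBr mxE [in X in _ + X = _]mxE; congr (_ - _).
  by rewrite /qform !mulmxA.
rewrite -scalemxAr mxE; congr (_ * _).
by rewrite enorm_sqr trmx_mul !mulmxA mulmxK.
Qed.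

Lemma quadratic_form_derivative (R : realType) (n k : nat) (a t : R)
    (P : R -> 'M[R]_n) (P' A : 'M[R]_n) (H : 'M[R]_(k, n)) (phi : R)
    (e : R -> 'cV[R]_n) :
  P t \in unitmx -> (P t)^T = P t -> has_deriv_from a P t P' ->
  has_deriv_from a e t
    (A *m e t - phi *: (invmx (P t) *m H^T *m (H *m e t))) ->
  has_deriv_from a (fun s => qform (P s) (e s) : R^o) t
    (2 * (qform (P t *m A) (e t) + 2^-1 * qform P' (e t)
      - phi * enorm (H *m e t) ^+ 2)).
Proof.
move=> uP symP dP de; set e' := (X in has_deriv_from _ _ _ X) in de.
have := has_deriv_from_coord (i := 0) (j := 0) (has_deriv_from_mulmx
  (has_deriv_from_mulmx (has_deriv_from_trmx de) dP) de).
set v := (X in has_deriv_from _ _ _ X); suff -> : v = 2 * (qform (P t *m A) (e t)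
    + 2^-1 * qform P' (e t) - phi * enorm (H *m e t) ^+ 2) by [].
have eP := error_derivative_form A H phi (e t) uP.
have tr (B : 'M[R]_1) : B 0 0 = B^T 0 0 by rewrite mxE.
(* A 1 by 1 matrix equals its transpose; by symmetry of [P t] the two cross terms coincide. *)
have e'P : (e'^T *m P t *m e t) 0 0 = ((e t)^T *m P t *m e') 0 0.
  by rewrite [LHS]tr !trmx_mul symP trmxK mulmxA.
rewrite /v mulmxDl mxE [X in X + _]mxE e'P eP /qform; by field.
Qed.

(** While [|e| <= xi], the product of [V = e' P e] with the exponential of twice the integral of
    [d1] is nonincreasing; a first exit time is then excluded. The equation for [z] is assumed only
    where [|e| <= xi], so that the lemma covers solutions of the observer and of its clipped version
    alike. *)
Lemma observer_estimate (R : realType) (n k l : nat)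
    (F : R -> 'cV[R]_n -> 'cV[R]_k -> 'cV[R]_n) (H : R -> 'M[R]_(k, n))
    (A : R -> 'cV[R]_l -> 'cV[R]_k -> 'M[R]_n) (Q : R -> set 'cV[R]_l)
    (P : R -> 'M[R]_n) (phi d1 db : R -> R) (x z : R -> 'cV[R]_n)
    (y : R -> 'cV[R]_k) (a L B xi : R) :
  C1_from a P -> (forall t, a <= t -> (P t)^T = P t) ->
  (forall t, a <= t -> mxform_ge (P t) 1%:M) -> opnorm (P a) <= L -> 1 < L ->
  {within `[a, +oo[, continuous d1} -> {within `[a, +oo[, continuous db} ->
  (forall t, a < t -> integral_from a t db < integral_from a t d1) ->
  (forall t, a <= t -> y t = H t *m x t) ->
  (forall t, a <= t -> has_deriv_from a x t (F t (x t) (y t))) ->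
  {within `[a, +oo[, continuous z} -> z a = 0 ->
  (forall t, a <= t -> enorm (x t - z t) <= xi ->
    has_deriv_from a z t (observer F H P phi t (z t) (y t))) ->
  (forall t, a <= t -> enorm (x t - z t) <= xi ->
    exists2 q, Q t q &
      F t (x t) (y t) - F t (z t) (y t) = A t q (y t) *m (x t - z t)) ->
  (forall t e q, a <= t -> Q t q ->
    qform (P t *m A t q (y t)) e + 2^-1 * qform (deriv_from a P t) e
      - phi t * enorm (H t *m e) ^+ 2 <= - d1 t * qform (P t) e) ->
  0 < B -> enorm (x a) <= B ->
  (forall t, a <= t -> B * Num.sqrt L * expR (- integral_from a t db) <= xi) ->
  forall t, a <= t ->
    enorm (x t - z t) < B * Num.sqrt L * expR (- integral_from a t db).
Proof.
move=> [dP _] symP P1 PL L1 d1c dbc dbd1 yx dx zc za dz FA ineq B0 xB Bxi.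
pose e t := x t - z t.
have xc : {within `[a, +oo[, continuous x}.
  exact: has_deriv_from_continuous dx.
have Pc : {within `[a, +oo[, continuous P}.
  exact: has_deriv_from_continuous dP.
have ec : {within `[a, +oo[, continuous e}.
  by move=> s; apply: cvgB; [exact: xc|exact: zc].
have uP t : a <= t -> P t \in unitmx by move=> at_; apply: mxform_ge1_unit; exact: P1.
have L0 : 0 < L by exact: lt_trans L1.
have sL0 : 0 < Num.sqrt L by rewrite sqrtr_gt0.
pose V t := qform (P t) (e t).
pose I1 t := integral_from a t d1.
have Vc : {within `[a, +oo[, continuous V}.
  by move=> s; apply: cvg_qform; [exact: Pc|exact: ec].
have I1c : {within `[a, +oo[, continuous I1} by exact: continuous_integral_from.
have V0 t : a <= t -> enorm (e t) ^+ 2 <= V t.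
  by move=> at_; rewrite -qform1; exact: P1.
have dV t : a <= t -> enorm (e t) <= xi ->
    exists2 v, has_deriv_from a (V : R -> R^o) t v & v <= - 2 * d1 t * V t.
  move=> at_ et; have [q Qq FAe] := FA t at_ et.
  have de : has_deriv_from a e t (A t q (y t) *m e t -
      phi t *: (invmx (P t) *m (H t)^T *m (H t *m e t))).
    have := has_deriv_fromB (dx t at_) (dz t at_ et).
    by rewrite /observer opprD addrA FAe (yx t at_) -mulmxBr.
  exists (2 * (qform (P t *m A t q (y t)) (e t)
      + 2^-1 * qform (deriv_from a P t) (e t) - phi t * enorm (H t *m e t) ^+ 2)).
    exact: quadratic_form_derivative (uP t at_) (symP t at_) (dP t at_) de.
  have := ineq t (e t) q at_ Qq; rewrite -/(V t) => h.
  rewrite (le_trans (ler_wpM2l _ h))//.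
  by rewrite le_eqVlt; apply/orP; left; apply/eqP; ring.
(* The bound at [T] uses [|e| <= xi] only before [T], as the exit argument requires. Strictness
   comes from [L > 1] at [T = a], and from the gap between the integrals of [db] and [d1] later. *)
have step T : a <= T -> (forall t, a <= t < T -> enorm (e t) <= xi) ->
    enorm (e T) < B * Num.sqrt L * expR (- integral_from a T db).
  move=> aT eT.
  have ea : e a = x a by rewrite /e za subr0.
  have [->|Ta] := eqVneq T a.
    rewrite integral_from_point oppr0 expR0 mulr1 ea (le_lt_trans xB)//.
    by rewrite ltr_pMr// -[ltLHS]sqrtr1 ltr_sqrt.
  have {}aT : a < T by rewrite lt_def Ta.
  have WT : V T * expR (2 * I1 T) <= V a * expR (2 * I1 a).
    (* A derivative of [V] is chosen as a total function, with default 0 where no claim is made. *)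
    have /choice[v vP] : forall t, exists v : R, a <= t -> enorm (e t) <= xi ->
        has_deriv_from a (V : R -> R^o) t v /\ v <= - 2 * d1 t * V t.
      move=> t; have [at_|ta] := boolP (a <= t); last by exists 0.
      have [et|et] := boolP (enorm (e t) <= xi); last by exists 0.
      by have [v] := dV t at_ et; exists v.
    apply: (@nonincreasing_from R a T (fun t => V t * expR (2 * I1 t))
      (fun t => v t * expR (2 * I1 t) + V t * ((0 * I1 t + 2 * d1 t) * expR (2 * I1 t)))).
    - exact: ltW.
    - move=> s; apply: cvgM; first exact: Vc.
      apply: (cvg_continuous _ (@continuous_expR R _)).
      by apply: cvgM; [exact: cvg_cst|exact: I1c].
    move=> t /andP[at_ tT].
    have [] := vP t (ltW at_) (eT t _); first by rewrite ltW.
    move=> dVt vle; split.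
      apply: is_derive1M; first exact: has_deriv_from_is_derive at_ dVt.
      exact: (is_derive1_expR (is_derive1M (is_derive_cst (2 : R) t 1)
        (is_derive_integral_from d1c at_))).
    rewrite mul0r add0r mulrA -mulrDl pmulr_lle0 ?expR_gt0//; lra.
  have VT : enorm (e T) ^+ 2 <= (B * Num.sqrt L * expR (- I1 T)) ^+ 2.
    have E1 : expR (- I1 T) ^+ 2 = (expR (2 * I1 T))^-1.
      by rewrite -expRN -expRM_natl; congr expR; ring.
    rewrite exprMn E1 ler_pdivlMr ?expR_gt0//.
    apply: (@le_trans _ _ (V T * expR (2 * I1 T))).
      by rewrite ler_wpM2r ?expR_ge0// V0// ltW.
    rewrite (le_trans WT)// /I1 integral_from_point mulr0 expR0 mulr1.
    rewrite exprMn sqr_sqrtr ?(ltW L0)// mulrC.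
    apply: le_trans (qform_le_opnorm _ L0 PL) _.
    by rewrite ler_wpM2l ?(ltW L0)// lerXn2r ?nnegrE ?enorm_ge0 ?(ltW B0)// ea.
  have BL0 : 0 < B * Num.sqrt L by rewrite mulr_gt0.
  have eI1 : enorm (e T) <= B * Num.sqrt L * expR (- I1 T).
    rewrite -(@ler_pXn2r _ 2)// nnegrE ?enorm_ge0//.
    by rewrite mulr_ge0 ?expR_ge0// ltW.
  apply: le_lt_trans eI1 _.
  by rewrite ltr_pM2l// ltr_expR ltrN2; exact: dbd1.
have [S0|S0] := pselect (exists t, a <= t /\ xi < enorm (e t)); last first.
  move=> t at_; apply: step => // s /andP[as_ _].
  by rewrite leNgt; apply/negP => h; apply: S0; exists s.
exfalso.
(* At the first exit time the estimate still gives [|e| < xi]. By continuity this persists for a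
   while, yet exit times accumulate there. *)
pose S := [set t | a <= t /\ xi < enorm (e t)].
have hS : has_inf S by split; [exact: S0|exists a => t []].
pose T := inf S.
have aT : a <= T by apply: lb_le_inf => [|t []//]; exact: S0.
have eT t : a <= t < T -> enorm (e t) <= xi.
  move=> /andP[at_ tT]; rewrite leNgt; apply/negP => h.
  have : T <= t by apply: ge_inf => //; exact: hS.2.
  by rewrite leNgt tT.
have eTxi : enorm (e T) < xi by exact: lt_le_trans (step T aT eT) (Bxi T aT).
have : enorm (e s) @[s --> within `[a, +oo[ (nbhs T)] --> enorm (e T).
  by apply: cvg_enorm; move/continuous_fromP : ec; exact.
move=> /cvgr_lt /(_ _ eTxi)[r /= r0 rP].
have [s [as_ es]] := inf_adherent r0 hS; rewrite -/T => sT.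
have Ts : T <= s by apply: ge_inf => //; exact: hS.2.
have : enorm (e s) < xi.
  apply: (rP s) => /=; last by rewrite in_itv/= as_.
  by rewrite ler0_norm ?subr_le0//; lra.
by rewrite ltNge (ltW es).
Qed.

(** * Existence for the observer by clipping the error *)

Lemma glue_ge_from (R : realType) (m : nat -> R) (a h t : R) :
  0 < h -> (forall j, 0 <= m j) -> a <= t ->
  exists2 j : nat, a + j%:R * h <= t <= a + j.+1%:R * h &
    m j <= glue m ((t - a) / h).
Proof.
move=> h0 m0 at_; pose u := (t - a) / h.
have u0 : 0 <= u by rewrite divr_ge0 ?subr_ge0// ltW.
have /andP[ju uj] := truncn_itv u0.
exists (Num.truncn u); last exact: glue_ge.
by rewrite -lerBrDl -ler_pdivlMr// ju/= -lerBlDl -ler_pdivrMr// ltW.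
Qed.

(** Projection onto a cube, the ball of the sup norm; acting on each coordinate makes it
    nonexpansive in that norm. *)
Definition clip (R : realType) (n : nat) (c : R) (v : 'cV[R]_n) : 'cV[R]_n :=
  \col_i Num.max (- c) (Num.min c (v i 0)).

Lemma clip_norm_le (R : realType) (n : nat) (c : R) (v : 'cV[R]_n) :
  0 <= c -> `|clip c v| <= c.
Proof.
move=> c0; apply: norm_mx_le => // i j; rewrite mxE ler_norml.
rewrite le_max lexx/= ge_max ge_min lexx/= andbT; lra.
Qed.

Lemma clip_lipschitz (R : realType) (n : nat) (c : R) (u v : 'cV[R]_n) :
  `|clip c u - clip c v| <= `|u - v|.
Proof.
apply: norm_mx_le => // i j; rewrite ord1 !mxE.
apply: (@le_trans _ _ `|u i 0 - v i 0|); last first.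
  by rewrite (le_trans _ (le_coord_norm _ i 0))// !mxE.
have [a|a] := leP c (u i 0); have [b|b] := leP c (v i 0);
  have [d|d] := leP (- c) (u i 0); have [f|f] := leP (- c) (v i 0);
  have [g|g] := leP (- c) c; rewrite ler_norml;
  have [h|h] := ger0P (u i 0 - v i 0); lra.
Qed.

Lemma clip_id (R : realType) (n : nat) (c : R) (v : 'cV[R]_n) :
  `|v| <= c -> clip c v = v.
Proof.
move=> vc; apply/colP => i; rewrite mxE.
have := le_trans (le_coord_norm v i 0) vc; rewrite ler_norml => /andP[h1 h2].
by rewrite min_r// max_r.
Qed.

Lemma cvg_clip (R : realType) (n : nat) (c : R) (T : Type) (G : set_system T)
    {FG : Filter G} (f : T -> 'cV[R]_n) (v : 'cV[R]_n) :
  f @ G --> v -> clip c (f s) @[s --> G] --> clip c v.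
Proof.
move=> fv; apply/cvgrPdist_lt => e e0.
have /cvgrPdist_lt /(_ e e0) := fv; apply: filterS => s.
exact: le_lt_trans (clip_lipschitz _ _ _).
Qed.

(** With [x - z] clipped, [F] is evaluated only within a bounded distance of the known trajectory
    [x], where it has a Lipschitz constant on each bounded time interval. The remaining term is
    affine in the state, so Picard iteration applies. *)
Lemma clipped_observer_exists (R : realType) (n k : nat)
    (F : R -> 'cV[R]_n -> 'cV[R]_k -> 'cV[R]_n) (H : R -> 'M[R]_(k, n))
    (P : R -> 'M[R]_n) (phi : R -> R) (x : R -> 'cV[R]_n)
    (y : R -> 'cV[R]_k) (a xi : R) :
  {within [set p : R * 'cV[R]_n * 'cV[R]_k | 0 <= p.1.1],
    continuous (fun p : R * 'cV[R]_n * 'cV[R]_k => F p.1.1 p.1.2 p.2)} ->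
  loc_lipschitz F -> {within `[0, +oo[, continuous H} -> 0 <= a -> 0 <= xi ->
  {within `[a, +oo[, continuous P} -> (forall t, a <= t -> P t \in unitmx) ->
  {within `[a, +oo[, continuous phi} -> {within `[a, +oo[, continuous x} ->
  {within `[a, +oo[, continuous y} ->
  exists z, solution (fun t z =>
    observer F H P phi t (x t - clip xi (x t - z)) (y t)) a 0 z.
Proof.
move=> Fc Fl Hc a0 xi0 Pc uP phic xc yc.
pose m := Num.max a.
have am t : a <= m t by rewrite le_max lexx.
pose X t := x (m t); pose Y t := y (m t).
have Xc : continuous X by exact: continuous_from_max.
have Yc : continuous Y by exact: continuous_from_max.
have mc : continuous m by exact: continuous_maxl.
have Hmc : continuous (fun t => H (m t)).
  apply: (within_continuous_comp (g := m) Hc) => // s.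
  by rewrite /= in_itv/= andbT (le_trans a0).
pose B t := phi (m t) *: (invmx (P (m t)) *m (H (m t))^T).
have Bc : continuous B.
  move=> t; apply: cvgZ; first exact: (continuous_from_max phic).
  apply: cvg_mulmx; last by apply: cvg_trmx; exact: Hmc.
  apply: cvg_invmx; [by apply: nearW => s; exact: uP|exact: uP|].
  exact: (continuous_from_max Pc).
have obsE t z w : observer F H P phi (m t) z w = F (m t) z w + B t *m (w - H (m t) *m z).
  by rewrite /observer /B -scalemxAl.
have Kc : continuous (fun t => B t *m H (m t)).
  by move=> t; apply: cvg_mulmx; [exact: Bc|exact: Hmc].
have /choice[C CP] : forall j : nat, exists C : R, 1 <= C /\
    forall t e1 e2, a + j%:R <= t <= a + j.+1%:R -> `|e1| <= xi -> `|e2| <= xi ->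
    `|F t (X t - e1) (Y t) - F t (X t - e2) (Y t)| <= C * `|e1 - e2|.
  move=> j; have aj : 0 <= a + j%:R by rewrite addr_ge0.
  have [C C1 CP] := lipschitz_bound (a + j.+1%:R) xi Fc Fl Xc Yc aj.
  by exists C.
have C0 j : 0 <= C j by rewrite (le_trans ler01)//; case: (CP j).
(* The Lipschitz constants of the unit time cells are majorized by one continuous function of
   time. *)
pose lamF t := glue C ((m t - a) / 1).
have lamFc : continuous lamF.
  apply: (continuous_from_max (f := fun t => glue C ((t - a) / 1))).
  apply: (@has_deriv_from_continuous R R^o a _ _ (glue_C1_from C a 1).1).
pose g t z := observer F H P phi (m t) (X t - clip xi (X t - z)) (Y t).
have gc (z : R -> 'cV[R]_n) : continuous z -> continuous (fun t => g t (z t)).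
  move=> zc t.
  have -> : (fun s => g s (z s)) = fun s => F (m s) (X s - clip xi (X s - z s)) (Y s)
      + B s *m (Y s - H (m s) *m (X s - clip xi (X s - z s))).
    by apply/funext => s; rewrite /g obsE.
  have wc : (X s - clip xi (X s - z s)) @[s --> t] --> X t - clip xi (X t - z t).
    apply: cvgB; first exact: Xc.
    by apply: cvg_clip; apply: cvgB; [exact: Xc|exact: zc].
  apply: cvgD.
    have h : (m s, X s - clip xi (X s - z s), Y s) @[s --> t] -->
        (m t, X t - clip xi (X t - z t), Y t).
      apply: cvg_pair_to; last exact: Yc.
      by apply: cvg_pair_to => //; exact: mc.
    have := cvg_continuous h (continuous_max_fst Fc (x := _)).
    rewrite /= max_r ?(le_trans a0)//.
    by under eq_fun do rewrite max_r ?(le_trans a0)//.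
  apply: cvg_mulmx; first exact: Bc.
  apply: cvgB; first exact: Yc.
  by apply: cvg_mulmx => //; exact: Hmc.
(* The three terms bound the Lipschitz constant of [F], that of the injection, and the size of the
   right-hand side at 0, all of which Picard iteration needs. *)
pose lam t := lamF t + n%:R * `|B t *m H (m t)| + `|g t 0|.
have lamc : continuous lam.
  move=> t; apply: cvgD; last first.
    apply: cvg_norm; apply: (gc (cst 0)) => s; exact: cvg_cst.
  apply: cvgD; first exact: lamFc.
  by apply: cvgM; [exact: cvg_cst|apply: cvg_norm; exact: Kc].
have lamF0 t : a <= t -> 0 <= lamF t.
  move=> at_; have [j _ jl] := glue_ge_from ltr01 C0 at_.
  by rewrite /lamF /m max_r// (le_trans _ jl).
have [t z1 z2 at_|t at_|z [za dz]] := @picard R n a g lam gc lamc.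
- have [j tj jl] := glue_ge_from ltr01 C0 at_; rewrite !mulr1 in tj.
  have mt : m t = t by rewrite /m max_r.
  have c12 : `|clip xi (X t - z1) - clip xi (X t - z2)| <= `|z1 - z2|.
    rewrite (le_trans (clip_lipschitz _ _ _))//.
    by rewrite opprB addrC addrA subrK distrC.
  rewrite /g !obsE.
  set c1 := clip _ _ in c12 *; set c2 := clip _ (_ - z2) in c12 *.
  have -> : F (m t) (X t - c1) (Y t) + B t *m (Y t - H (m t) *m (X t - c1)) -
      (F (m t) (X t - c2) (Y t) + B t *m (Y t - H (m t) *m (X t - c2))) =
    F (m t) (X t - c1) (Y t) - F (m t) (X t - c2) (Y t)
      + B t *m H (m t) *m (c1 - c2).
    rewrite opprD addrACA -mulmxBr; congr (_ + _).
    rewrite -mulmxA; congr (_ *m _).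
    rewrite opprB addrC addrA subrK -mulmxBr; congr (_ *m _).
    by rewrite opprB addrC addrA subrK.
  rewrite (le_trans (ler_normD _ _))//.
  apply: (@le_trans _ _ ((lamF t + n%:R * `|B t *m H (m t)|) * `|c1 - c2|)).
    rewrite mulrDl lerD ?norm_mulmx_le// mt.
    have [_ Cj] := CP j; rewrite (le_trans (Cj _ _ _ tj _ _)) ?clip_norm_le//.
    by rewrite ler_wpM2r// /lamF mt.
  apply: ler_pM => //; last by rewrite /lam lerDl.
  by rewrite addr_ge0 ?mulr_ge0 ?lamF0.
- by rewrite /lam lerDr addr_ge0 ?mulr_ge0 ?lamF0.
exists z; split; first exact: za.
move=> t at_; have mt : m t = t by rewrite /m max_r.
have gt : g t (z t) = observer F H P phi t (x t - clip xi (x t - z t)) (y t).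
  by rewrite /g /X /Y mt.
by rewrite -gt; exact: dz.
Qed.

Lemma clip_enorm_id (R : realType) (n : nat) (c : R) (v : 'cV[R]_n) :
  enorm v <= c -> clip c v = v.
Proof. by move=> vc; apply: clip_id; exact: le_trans (norm_le_enorm v) vc. Qed.

(** Finsler's lemma needs strict negativity on the kernel. It comes from the gap [d1 < d], because
    the form of [P t] is positive on nonzero vectors. *)
Lemma penalty_exists (R : realType) (n k l : nat) (H : R -> 'M[R]_(k, n))
    (A : R -> 'cV[R]_l -> 'cV[R]_k -> 'M[R]_n) (Q : R -> set 'cV[R]_l)
    (P P' : R -> 'M[R]_n) (d d1 : R -> R) (y : R -> 'cV[R]_k)
    (t0 tb a b : R) :
  {within `[0, +oo[, continuous H} ->
  {within [set p : R * 'cV[R]_l * 'cV[R]_k | 0 <= p.1.1],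
     continuous (fun p : R * 'cV[R]_l * 'cV[R]_k => A p.1.1 p.1.2 p.2)} ->
  0 <= t0 -> t0 <= tb -> tb <= a -> CP t0 Q ->
  {within `[tb, +oo[, continuous P} -> {within `[tb, +oo[, continuous P'} ->
  {within `[tb, +oo[, continuous d1} -> {within `[tb, +oo[, continuous y} ->
  (forall t, tb <= t -> mxform_ge (P t) 1%:M) ->
  (forall t, tb <= t -> d1 t < d t) ->
  (forall t e q, tb <= t -> H t *m e = 0 -> Q t q ->
    qform (P t *m A t q (y t)) e + 2^-1 * qform (P' t) e
      <= - d t * qform (P t) e) ->
  exists m, 1 <= m /\ forall t e q, a <= t <= b -> Q t q ->
    qform (P t *m A t q (y t)) e + 2^-1 * qform (P' t) e
      + d1 t * qform (P t) e <= m * enorm (H t *m e) ^+ 2.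
Proof.
move=> Hc Ac t00 t0tb tba Qcp Pc P'c d1c yc P1 d1d neg.
pose m := Num.max tb.
have tbm t : tb <= m t by rewrite le_max lexx.
have m0 t : 0 <= m t by rewrite (le_trans t00)// (le_trans t0tb).
have mE t : tb <= t -> m t = t by move=> tbt; rewrite /m max_r.
have mc : continuous m by exact: continuous_maxl.
pose psi t q e := qform (P (m t) *m A (m t) q (y (m t))) e
  + 2^-1 * qform (P' (m t)) e + d1 (m t) * qform (P (m t)) e.
have Hmc : continuous (fun t => H (m t)).
  by apply: (within_continuous_comp (g := m) Hc) => // s; rewrite /= in_itv/= andbT.
have Amc : continuous (fun p : R * 'cV[R]_l * 'cV[R]_k => A (m p.1.1) p.1.2 p.2).
  have := continuous_max_fst (f := A) (a := 0) Ac => Ac' p.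
  have h : (m q.1.1, q.1.2, q.2) @[q --> p] --> (m p.1.1, p.1.2, p.2).
    have p1 : q.1 @[q --> p] --> p.1 by exact: cvg_fst.
    apply: cvg_pair_to; last exact: cvg_snd.
    apply: cvg_pair_to; last exact: cvg_continuous p1 (@continuous_snd _ _ _).
    exact: cvg_continuous (cvg_continuous p1 (@continuous_fst _ _ p.1)) (mc _).
  have := cvg_continuous h (Ac' _); rewrite /= max_r//.
  by under eq_fun do rewrite max_r//.
have psic : continuous (fun p : R * 'cV[R]_l * 'cV[R]_n => psi p.1.1 p.1.2 p.2).
  move=> p.
  have p1 : q.1 @[q --> p] --> p.1 by exact: cvg_fst.
  have p2 : q.2 @[q --> p] --> p.2 by exact: cvg_snd.
  have p11 : q.1.1 @[q --> p] --> p.1.1.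
    exact: cvg_continuous p1 (@continuous_fst _ _ p.1).
  have p12 : q.1.2 @[q --> p] --> p.1.2.
    exact: cvg_continuous p1 (@continuous_snd _ _ p.1).
  have Pp : P (m q.1.1) @[q --> p] --> P (m p.1.1).
    exact: cvg_continuous p11 (continuous_from_max Pc (x := _)).
  have P'p : P' (m q.1.1) @[q --> p] --> P' (m p.1.1).
    exact: cvg_continuous p11 (continuous_from_max P'c (x := _)).
  have dp : d1 (m q.1.1) @[q --> p] --> d1 (m p.1.1).
    exact: cvg_continuous p11 (continuous_from_max d1c (x := _)).
  have yp : y (m q.1.1) @[q --> p] --> y (m p.1.1).
    exact: cvg_continuous p11 (continuous_from_max yc (x := _)).
  have Ap : A (m q.1.1) q.1.2 (y (m q.1.1)) @[q --> p] -->
      A (m p.1.1) p.1.2 (y (m p.1.1)).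
    exact: cvg_continuous (cvg_pair_to (cvg_pair_to p11 p12) yp) (Amc _).
  apply: cvgD; last by apply: cvgM => //; exact: cvg_qform.
  apply: cvgD; last by apply: cvgM; [exact: cvg_cst|exact: cvg_qform].
  by apply: cvg_qform => //; exact: cvg_mulmx.
have [||t e q at_ e0 He Qq|C C1 CP] :=
    @finsler_bound R n k l (fun t => H (m t)) Q psi t0 a b Hmc psic _ Qcp.
- by move=> t q c e; rewrite /psi !qformZ; ring.
- exact: le_trans tba.
- have tbt := le_trans tba at_; rewrite mE// in He; rewrite /psi mE//.
  have := neg t e q tbt He Qq; have := d1d t tbt; have := P1 t tbt e.
  rewrite qform1 => h1 h2 h3.
  have : 0 < enorm e ^+ 2.
    by rewrite exprn_gt0// lt_def enorm_ge0 andbT; apply: contra_neq e0; exact: enorm_eq0.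
  nra.
exists C; split => // t e q abt Qq; have /andP[at_ _] := abt.
by have := CP t e q abt Qq; rewrite /psi mE// (le_trans tba).
Qed.

Lemma continuous_observer (R : realType) (n k : nat)
    (F : R -> 'cV[R]_n -> 'cV[R]_k -> 'cV[R]_n) (H : R -> 'M[R]_(k, n))
    (P : R -> 'M[R]_n) (phi : R -> R) (a : R) :
  {within [set p : R * 'cV[R]_n * 'cV[R]_k | 0 <= p.1.1],
    continuous (fun p : R * 'cV[R]_n * 'cV[R]_k => F p.1.1 p.1.2 p.2)} ->
  {within `[0, +oo[, continuous H} -> 0 <= a ->
  {within `[a, +oo[, continuous P} -> (forall t, a <= t -> P t \in unitmx) ->
  {within `[a, +oo[, continuous phi} ->
  {within [set p : R * 'cV[R]_n * 'cV[R]_k | a <= p.1.1],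
    continuous (fun p : R * 'cV[R]_n * 'cV[R]_k =>
      observer F H P phi p.1.1 p.1.2 p.2)}.
Proof.
move=> Fc Hc a0 Pc uP phic.
pose m := Num.max a.
have am t : a <= m t by rewrite le_max lexx.
have mc : continuous m by exact: continuous_maxl.
have Hmc : continuous (fun t => H (m t)).
  apply: (within_continuous_comp (g := m) Hc) => // s.
  by rewrite /= in_itv/= andbT (le_trans a0).
apply: (@subspace_eq_continuous _ _ _ (fun p : R * 'cV[R]_n * 'cV[R]_k =>
    observer F H P phi (m p.1.1) p.1.2 p.2)).
  by move=> p; rewrite inE /= => ap; rewrite /m max_r.
apply: continuous_subspaceT => p.
have p1 : q.1 @[q --> p] --> p.1 by exact: cvg_fst.
have p2 : q.2 @[q --> p] --> p.2 by exact: cvg_snd.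
have p11 : q.1.1 @[q --> p] --> p.1.1.
  exact: cvg_continuous p1 (@continuous_fst _ _ p.1).
have p12 : q.1.2 @[q --> p] --> p.1.2.
  exact: cvg_continuous p1 (@continuous_snd _ _ p.1).
have Pp : P (m q.1.1) @[q --> p] --> P (m p.1.1).
  exact: cvg_continuous p11 (continuous_from_max Pc (x := _)).
have Hp : H (m q.1.1) @[q --> p] --> H (m p.1.1).
  exact: cvg_continuous p11 (Hmc _).
apply: cvgD.
  have h : (m q.1.1, q.1.2, q.2) @[q --> p] --> (m p.1.1, p.1.2, p.2).
    exact: cvg_pair_to (cvg_pair_to (cvg_continuous p11 (mc _)) p12) p2.
  have := cvg_continuous h (continuous_max_fst Fc (x := _)).
  rewrite /= max_r ?(le_trans a0)//.
  by under eq_fun do rewrite max_r ?(le_trans a0)//.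
apply: cvgZ; first exact: cvg_continuous p11 (continuous_from_max phic (x := _)).
apply: cvg_mulmx; last by apply: cvgB => //; exact: cvg_mulmx.
apply: cvg_mulmx; last exact: cvg_trmx.
by apply: cvg_invmx => //; [apply: nearW => q; exact: uP|exact: uP].
Qed.

(** For [c > 0] the correction costs less than [c] in total: the lower bound on the integral drops
    by less than [c] and divergence to infinity survives. *)
Lemma integral_from_sub_exp (R : realType) (a t c : R) (d : R -> R) :
  {within `[a, +oo[, continuous d} -> a <= t ->
  integral_from a t (fun s => d s - c * expR (- (s - a))) =
  integral_from a t d - c * (1 - expR (- (t - a))).
Proof.
move=> dc at_.
have dexp (s : R) : is_derive s 1 (fun s : R => expR (- (s - a))) (- expR (- (s - a))).
  have := is_derive1_expR (is_derive1N (is_derive1B (is_derive_id s 1)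
    (is_derive_cst a s 1))).
  by rewrite subr0 mulN1r.
have expc : continuous (fun s : R => expR (- (s - a))).
  by move=> s; exact: is_derive1_continuous (dexp s).
apply: (integral_from_eq (G := fun t => integral_from a t d - c * (1 - expR (- (t - a))))) => //.
- move=> s; apply: cvgB; first exact: dc.
  have : continuous (fun s : R => c * expR (- (s - a))).
    by move=> u; apply: cvgM; [exact: cvg_cst|exact: expc].
  by move/continuous_subspaceT; exact.
- move=> s; apply: cvgB; first exact: continuous_integral_from.
  have : continuous (fun s : R => c * (1 - expR (- (s - a)))).
    move=> u; apply: cvgM; first exact: cvg_cst.
    by apply: cvgB; [exact: cvg_cst|exact: expc].
  by move/continuous_subspaceT; exact.
- move=> s as_.
  have := is_derive1B (is_derive_integral_from dc as_) (is_derive1M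
    (is_derive_cst c s 1) (is_derive1B (is_derive_cst (1 : R) s 1) (dexp s))).
  by rewrite mul0r add0r sub0r opprK.
by rewrite integral_from_point subrr oppr0 expR0 subrr mulr0 subrr.
Qed.

Lemma integral_fromN (R : realType) (a t : R) (d : R -> R) :
  {within `[a, +oo[, continuous d} -> a <= t ->
  integral_from a t (fun s => - d s) = - integral_from a t d.
Proof.
move=> dc at_; apply: (integral_from_eq (G := fun t => - integral_from a t d)) => //.
- by move=> s; apply: cvgN; exact: dc.
- by move=> s; apply: cvgN; exact: continuous_integral_from.
- by move=> s as_; exact: is_derive1N (is_derive_integral_from dc as_).
by rewrite integral_from_point oppr0.
Qed.

(** * Construction of the observer from (A1) and (A2) *)

Unset Implicit Arguments.
Set Strict Implicit.

Theorem proposition2p2 (R : realType) (n k l : nat)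
  (H : R -> 'M[R]_(k, n))
  (F : R -> 'cV[R]_n -> 'cV[R]_k -> 'cV[R]_n)
  (M : set 'cV[R]_n) (beta : R -> R -> R -> R) (rad : R)
  (A : R -> 'cV[R]_l -> 'cV[R]_k -> 'M[R]_n) (L epsR : R)
  (* Q t0 xi t *)
  (Q : R -> R -> R -> set 'cV[R]_l)
  (* P t0 tb tau0 xi y t  and  d t0 tb tau0 xi y t *)
  (P : R -> R -> R -> R -> (R -> 'cV[R]_k) -> R -> 'M[R]_n)
  (d : R -> R -> R -> R -> (R -> 'cV[R]_k) -> R -> R) :
  let f := fun t x => F t x (H t *m x) in
  let h := fun t x => H t *m x in
  let MR := eball rad `&` M in
  {within `[0, +oo[, continuous H} ->
  {within [set p : R * 'cV[R]_n * 'cV[R]_k | 0 <= p.1.1],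
     continuous (fun p : R * 'cV[R]_n * 'cV[R]_k => F p.1.1 p.1.2 p.2)} ->
  loc_lipschitz F ->
  M !=set0 -> closure M 0 ->
  classNNN beta -> forward_complete f M beta ->
  0 < rad -> 1 < L ->
  {within [set p : R * 'cV[R]_l * 'cV[R]_k | 0 <= p.1.1],
     continuous (fun p : R * 'cV[R]_l * 'cV[R]_k => A p.1.1 p.1.2 p.2)} ->
  (* (A1) *)
  (forall t0 xi : R, 0 <= t0 -> 0 < xi ->
     CP t0 (Q t0 xi) /\
     forall t, t0 <= t ->
     forall y, (exists2 x, y = H t *m x & enorm x <= beta t t0 rad) ->
     forall x z, enorm x <= beta t t0 rad -> enorm (x - z) <= xi ->
     exists2 q, Q t0 xi t q & F t x y - F t z y = A t q y *m (x - z)) ->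
  (* (A2) *)
  0 < epsR ->
  (forall t0 xi tb tau0 : R, 0 <= t0 -> 0 < xi -> t0 <= tb -> 0 < tau0 ->
     [/\ noncausal tau0 t0 tb (outputs f h M t0) (P t0 tb tau0 xi),
         noncausal tau0 t0 tb (outputs f h M t0) (d t0 tb tau0 xi) &
     forall y, outputs f h M t0 y ->
     let PR := P t0 tb tau0 xi y in
     let dR := d t0 tb tau0 xi y in
     [/\ C1_from tb PR /\ (forall t, tb <= t -> (PR t)^T = PR t),
         {within `[tb, +oo[, continuous dR},
         (forall t, tb <= t -> mxform_ge (PR t) 1%:M) /\ opnorm (PR tb) <= L,
         (forall t, tb <= t -> - epsR < integral_from tb t dR) /\
         integral_from tb t dR @[t --> +oo] --> +oo &
         outputs f h MR t0 y ->
         forall t e q, tb <= t -> H t *m e = 0 -> Q t0 xi t q ->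
           qform (PR t *m A t q (y t)) e
             + 2^-1 * qform (deriv_from tb PR t) e
           <= - dR t * qform (PR t) e]]) ->
  ACODP_solvable f h MR /\
  forall t0 tb tau epsb xi : R,
    0 <= t0 -> t0 <= tb -> 0 < tau -> epsR < epsb ->
    beta tb t0 rad * Num.sqrt L * expR epsb <= xi ->
  exists tau0 : R, 0 < tau0 < tau /\
  exists (PR : (R -> 'cV[R]_k) -> R -> 'M[R]_n)
         (db phi : (R -> 'cV[R]_k) -> R -> R),
    [/\ noncausal tau t0 tb (outputs f h MR t0) PR,
        noncausal tau t0 tb (outputs f h MR t0) db,
        noncausal tau t0 tb (outputs f h MR t0) phi &
    forall y, outputs f h MR t0 y ->
    let obs := fun t z => F t z (y t)
      + phi y t *: (invmx (PR y t) *m (H t)^T *m (y t - H t *m z)) in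
    [/\ [/\ C1_from tb (PR y), (forall t, tb <= t -> (PR y t)^T = PR y t),
            (forall t, tb <= t -> mxform_ge (PR y t) 1%:M) &
            opnorm (PR y tb) <= L],
        {within `[tb, +oo[, continuous (db y)} /\
        (C1_from tb (phi y : R -> R^o) /\ forall t, tb <= t -> 0 < phi y t),
        [/\ (forall t, tb <= t -> db y t < d t0 tb tau0 xi y t),
            (forall t, tb <= t -> - epsb < integral_from tb t (db y)) &
            integral_from tb t (db y) @[t --> +oo] --> +oo],
        (forall t e q, tb <= t -> Q t0 xi t q ->
           qform (PR y t *m A t q (y t)) e
             + 2^-1 * qform (deriv_from tb (PR y) t) e
             - phi y t * enorm (H t *m e) ^+ 2
           <= - db y t * qform (PR y t) e) &
        (* (i), (ii) *)
        (exists z, solution obs tb 0 z) /\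
        forall x z, traj_with_output f h MR t0 y x -> solution obs tb 0 z ->
          (fun t => x t - z t) @ +oo --> (0 : 'cV[R]_n) /\
          forall t, tb <= t ->
            enorm (x t - z t) <
              beta tb t0 rad * Num.sqrt L
                * expR (integral_from tb t (fun s => - db y s))]].
Proof.
move=> f h MR Hc Fc Fl _ _ [_ betaN] fc rad0 L1 Ac A1 epsR0 A2.
(* Noncausality in (A2) refers to outputs from [M]; it passes to the smaller family of outputs from
   [MR]. *)
have MRM t0 y : outputs f h MR t0 y -> outputs f h M t0 y.
  by case=> -[x [[x0 [_ Mx0] sx] xy]] yc; split => //; exists x; split => //; exists x0.
have L0 : 0 < L by exact: lt_trans L1.
have beta_gt0 t t0 : 0 <= t -> 0 <= t0 -> 0 < beta t t0 rad.
  move=> t_0 t00; have [_ _ [_ b0 blt]] := betaN t t0 t_0 t00.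
  exact: le_lt_trans (b0 0 (lexx _)) (blt _ _ (lexx _) rad0).
have trajP t0 y x : 0 <= t0 -> traj_with_output f h MR t0 y x ->
    [/\ forall t, t0 <= t -> has_deriv_from t0 x t (F t (x t) (y t)),
        forall t, t0 <= t -> y t = H t *m x t &
        forall t, t0 <= t -> enorm (x t) <= beta t t0 rad].
  move=> t00 [[x0 [x0r Mx0] sx] xy]; split => // t t0t.
    by rewrite xy//; exact: sx.2.
  have [_ /(_ x sx t t0t) h1] := fc t0 x0 t00 Mx0.
  rewrite (le_trans h1)//.
  have [_ _ [_ _ blt]] := betaN t t0 (le_trans t00 t0t) t00.
  have [->//|x0ne] := eqVneq (enorm x0) rad.
  apply: ltW; apply: blt; first exact: enorm_ge0.
  by rewrite lt_neqAle x0ne; exact: x0r.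
(* Solvability follows from the quantitative part with [epsb = epsR + 1], the smallest admissible
   [xi], the observer as [g] and [[set 0]] as set of initial states. *)
suff main : forall t0 tb tau epsb xi : R,
    0 <= t0 -> t0 <= tb -> 0 < tau -> epsR < epsb ->
    beta tb t0 rad * Num.sqrt L * expR epsb <= xi ->
    exists tau0 : R, 0 < tau0 < tau /\
    exists (PR : (R -> 'cV[R]_k) -> R -> 'M[R]_n)
           (db phi : (R -> 'cV[R]_k) -> R -> R),
    [/\ noncausal tau t0 tb (outputs f h MR t0) PR,
        noncausal tau t0 tb (outputs f h MR t0) db,
        noncausal tau t0 tb (outputs f h MR t0) phi &
    forall y, outputs f h MR t0 y ->
    let obs := fun t z => observer F H (PR y) (phi y) t z (y t) in
    [/\ [/\ C1_from tb (PR y), (forall t, tb <= t -> (PR y t)^T = PR y t),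
            (forall t, tb <= t -> mxform_ge (PR y t) 1%:M) &
            opnorm (PR y tb) <= L],
        {within `[tb, +oo[, continuous (db y)} /\
        (C1_from tb (phi y : R -> R^o) /\ forall t, tb <= t -> 0 < phi y t),
        [/\ (forall t, tb <= t -> db y t < d t0 tb tau0 xi y t),
            (forall t, tb <= t -> - epsb < integral_from tb t (db y)) &
            integral_from tb t (db y) @[t --> +oo] --> +oo],
        (forall t e q, tb <= t -> Q t0 xi t q ->
           qform (PR y t *m A t q (y t)) e
             + 2^-1 * qform (deriv_from tb (PR y) t) e
             - phi y t * enorm (H t *m e) ^+ 2
           <= - db y t * qform (PR y t) e) &
        (exists z, solution obs tb 0 z) /\
        forall x z, traj_with_output f h MR t0 y x -> solution obs tb 0 z ->
          (fun t => x t - z t) @ +oo --> (0 : 'cV[R]_n) /\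
          forall t, tb <= t ->
            enorm (x t - z t) <
              beta tb t0 rad * Num.sqrt L
                * expR (integral_from tb t (fun s => - db y s))]].
  split; last exact: main.
  move=> t0 tb tau t00 t0tb tau0.
  have eps1 : epsR < epsR + 1 by rewrite ltrDl.
  have [tau1 [_ [PR [db [phi [PRn _ phin obsP]]]]]] :=
    main t0 tb tau (epsR + 1) _ t00 t0tb tau0 eps1 (lexx _).
  exists (fun y t z w => observer F H (PR y) (phi y) t z w); split.
    move=> y1 y2 Y1 Y2 t tbt y12; apply/funext => z; apply/funext => w.
    by rewrite /observer (PRn y1 y2) ?(phin y1 y2).
  move=> y Yy; have [[P1 _ Pge _] [_ [phi1 _]] _ _ [zex zP]] := obsP y Yy.
  split.
    apply: continuous_observer => //; first exact: le_trans t0tb.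
    - exact: has_deriv_from_continuous P1.1.
    - by move=> t tbt; apply: mxform_ge1_unit; exact: Pge.
    - exact: (has_deriv_from_continuous phi1.1).
  exists [set 0]; split; first by exists 0.
  move=> _ ->; split=> // x z xP zs.
  by have [] := zP x z xP zs.
move=> t0 tb tau epsb xi t00 t0tb tau_gt0 epsRb xiP.
have tb0 : 0 <= tb := le_trans t00 t0tb.
have B0 := beta_gt0 tb t0 tb0 t00; set B := beta tb t0 rad in B0 xiP *.
have xi0 : 0 < xi.
  by apply: lt_le_trans xiP; rewrite !mulr_gt0 ?expR_gt0 ?sqrtr_gt0.
have h4 : 0 < tau / 8 by rewrite divr_gt0.
have tau2 : 0 < tau / 2 by rewrite divr_gt0.
have [Pn dn A2y] := A2 t0 xi tb (tau / 2) t00 xi0 t0tb tau2.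
have [Qcp Aq] := A1 t0 xi t00 xi0.
(* Half of the slack: the rate [d1] is [dsub c] and the rate [db] is [dsub (2 * c)], whose total
   loss stays below [epsb - epsR]. *)
pose c := (epsb - epsR) / 2.
have c0 : 0 < c by rewrite divr_gt0 ?subr_gt0.
pose PR := P t0 tb (tau / 2) xi; pose D := d t0 tb (tau / 2) xi.
pose dsub r y t := D y t - r * expR (- (t - tb)).
pose S y (j : nat) : set R := [set m | 1 <= m /\ forall t e q,
  tb + j%:R * (tau / 8) <= t <= tb + j.+1%:R * (tau / 8) -> Q t0 xi t q ->
  qform (PR y t *m A t q (y t)) e + 2^-1 * qform (deriv_from tb (PR y) t) e
    + dsub c y t * qform (PR y t) e <= m * enorm (H t *m e) ^+ 2].
(* The choice depends only on the set [S y j], so outputs with equal sets get equal constants; this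
   makes the gain noncausal. The default 1 is never reached for outputs, whose sets are nonempty. *)
pose m y j := xget 1 (S y j).
pose phi y t := glue (m y) ((t - tb) / (tau / 8)).
have tbj (j : nat) : tb <= tb + j%:R * (tau / 8).
  by rewrite lerDl mulr_ge0// ltW.
exists (tau / 2); split; first by apply/andP; split; lra.
exists PR, (dsub (2 * c)), phi; split.
- move=> y1 y2 /MRM Y1 /MRM Y2 t tbt y12; apply: Pn => // s t0s st.
  by apply: y12 => //; lra.
- move=> y1 y2 /MRM Y1 /MRM Y2 t tbt y12; rewrite /dsub /D (dn y1 y2)// => s t0s st.
  by apply: y12 => //; lra.
- move=> y1 y2 Y1 Y2 t tbt y12; apply: eq_glue.
    by rewrite divr_ge0 ?subr_ge0// ltW.
  (* Look-ahead in units of [tau / 8]: relevant cells end before [t] plus 2, the derivative of [P]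
     needs 1 more, and the horizon [tau / 2] of (A2) adds 4. The total 7 is below 8. *)
  move=> i iu; rewrite /m; congr (xget 1 _).
  have it : i%:R * (tau / 8) < t - tb + tau / 8.
    by move: iu; rewrite -(ltr_pM2r h4) mulrDl mul1r divfK// gt_eqF.
  have [[P1C1 _] _ _ _ _] := A2y y1 (MRM _ _ Y1).
  have [[P2C1 _] _ _ _ _] := A2y y2 (MRM _ _ Y2).
  have PE s : tb <= s -> s < t + 3 * (tau / 8) -> PR y1 s = PR y2 s.
    move=> tbs st; apply: Pn => //; [exact: MRM|exact: MRM|].
    by move=> r t0r rs; apply: y12 => //; lra.
  have DE s : tb <= s -> s < t + 3 * (tau / 8) -> D y1 s = D y2 s.
    move=> tbs st; apply: dn => //; [exact: MRM|exact: MRM|].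
    by move=> r t0r rs; apply: y12 => //; lra.
  have allE s : tb + i%:R * (tau / 8) <= s <= tb + i.+1%:R * (tau / 8) ->
      [/\ y1 s = y2 s, PR y1 s = PR y2 s, dsub c y1 s = dsub c y2 s &
        deriv_from tb (PR y1) s = deriv_from tb (PR y2) s].
    move=> /andP[is_ si]; have tbs : tb <= s := le_trans (tbj i) is_.
    have st : s < t + 2 * (tau / 8).
      by apply: le_lt_trans si _; rewrite -natr1 mulrDl mul1r; lra.
    split.
    - by apply: y12; [exact: le_trans tbs|lra].
    - by apply: PE => //; lra.
    - by rewrite /dsub DE//; lra.
    apply: (deriv_from_near tbs h4 _ (P1C1.1 s tbs) (P2C1.1 s tbs)) => r tbr rs.
    by apply: PE => //; lra.
  apply/seteqP; split=> v [v1 vP]; split=> // s e q si Qq;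
    have [E1 E2 E3 E4] := allE s si; have := vP s e q si Qq.
    by rewrite E1 E2 E3 E4.
  by rewrite E1 E2 E3 E4.
move=> y Yy obs.
have yc0 := Yy.2.
have [[PC1 Psym] Dc [Pge PL] [Deps Doo] neg] := A2y y (MRM _ _ Yy).
have Pc := has_deriv_from_continuous PC1.1.
have sub_itv : `[tb, +oo[%classic `<=` `[t0, +oo[%classic.
  by move=> s /=; rewrite !in_itv/= !andbT; exact: le_trans.
have yc : {within `[tb, +oo[, continuous y} by exact: continuous_subspaceW sub_itv yc0.
have dsubc r : {within `[tb, +oo[, continuous (dsub r y)}.
  have ec : continuous (fun s : R => r * expR (- (s - tb))).
    move=> s; apply: cvgM; first exact: cvg_cst.
    apply: (cvg_continuous _ (@continuous_expR R _)).
    by apply: cvgN; apply: cvgB; [exact: cvg_id|exact: cvg_cst].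
  by move=> s; apply: cvgB; [exact: Dc|exact: (continuous_subspaceT ec)].
have dsubI r t : tb <= t -> integral_from tb t (dsub r y) =
    integral_from tb t (D y) - r * (1 - expR (- (t - tb))).
  exact: integral_from_sub_exp.
have dsub_lt r t : 0 < r -> dsub r y t < D y t.
  by move=> r0; rewrite /dsub gtrBl mulr_gt0 ?expR_gt0.
have mS j : S y j (m y j).
  have [v vP] := penalty_exists (tb + j.+1%:R * (tau / 8)) Hc Ac t00 t0tb
    (tbj j) Qcp Pc PC1.2 (dsubc c) yc Pge (fun t _ => dsub_lt c t c0) (neg Yy).
  by apply: xgetPex; exists v; exact: vP.
have m1 j : 1 <= m y j by case: (mS j).
have m0 j : 0 <= m y j by exact: le_trans (m1 j).
have ineq t e q : tb <= t -> Q t0 xi t q ->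
    qform (PR y t *m A t q (y t)) e + 2^-1 * qform (deriv_from tb (PR y) t) e
      - phi y t * enorm (H t *m e) ^+ 2 <= - dsub c y t * qform (PR y t) e.
  move=> tbt Qq; have [j tj mj] := glue_ge_from h4 m0 tbt.
  have [_ /(_ t e q tj Qq) h1] := mS j.
  have h2 : m y j * enorm (H t *m e) ^+ 2 <= phi y t * enorm (H t *m e) ^+ 2.
    by rewrite ler_wpM2r// sqr_ge0.
  by rewrite lerBlDr mulNr -lerBlDl opprK; lra.
have phiC1 := glue_C1_from (m y) tb (tau / 8).
have Ieps t : tb <= t -> - epsb < integral_from tb t (dsub (2 * c) y).
  move=> tbt; rewrite dsubI//; have := Deps t tbt.
  have : 0 < 2 * c * expR (- (t - tb)) by apply: mulr_gt0; [exact: mulr_gt0|exact: expR_gt0].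
  have c2 : 2 * c = epsb - epsR by rewrite /c; field.
  by rewrite c2 -/(D y); lra.
have Ioo : integral_from tb t (dsub (2 * c) y) @[t --> +oo] --> +oo.
  apply/cvgryPge => a; have /cvgryPge /(_ (a + 2 * c)) := Doo.
  have : \forall t \near +oo, tb <= t by apply: nbhs_pinfty_ge; exact: num_real.
  apply: filterS2 => t tbt at_; rewrite dsubI//.
  have : 0 < 2 * c * expR (- (t - tb)) by apply: mulr_gt0; [exact: mulr_gt0|exact: expR_gt0].
  by move: at_; rewrite -/(D y); lra.
have bound_xi t : tb <= t ->
    B * Num.sqrt L * expR (- integral_from tb t (dsub (2 * c) y)) <= xi.
  move=> tbt; apply: le_trans xiP.
  rewrite ler_wpM2l ?mulr_ge0 ?sqrtr_ge0 ?(ltW B0)// ler_expR lerNl ltW//.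
  exact: Ieps.
(* The equation for [z] is required only while [|x - z| <= xi]: this serves first the clipped
   solution, then any solution of the observer. *)
have estimate (x z : R -> 'cV[R]_n) : traj_with_output f h MR t0 y x ->
    {within `[tb, +oo[, continuous z} -> z tb = 0 ->
    (forall t, tb <= t -> enorm (x t - z t) <= xi ->
      has_deriv_from tb z t (obs t (z t))) ->
    forall t, tb <= t -> enorm (x t - z t) <
      B * Num.sqrt L * expR (- integral_from tb t (dsub (2 * c) y)).
  move=> xP zc z0 dz; have [dx yx xb] := trajP t0 y x t00 xP.
  apply: (observer_estimate (H := H) (F := F) (A := A) (Q := Q t0 xi) (P := PR y)
    (phi := phi y) (d1 := dsub c y) (y := y) (xi := xi)) => //.
  - move=> t tbt; rewrite !dsubI ?(ltW tbt)// ltrD2l ltrN2.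
    have : expR (- (t - tb)) < 1 by rewrite -expR0 ltr_expR oppr_lt0 subr_gt0.
    by move=> e1; rewrite ltr_pM2r ?subr_gt0//; lra.
  - by move=> t tbt; apply: yx; exact: le_trans tbt.
  - move=> t tbt; apply: (has_deriv_from_le t0tb); apply: dx; exact: le_trans tbt.
  - move=> t tbt ext; apply: (Aq t _ (y t)) => //; first exact: le_trans tbt.
      exists (x t); [apply: yx|apply: xb]; exact: le_trans tbt.
    by apply: xb; exact: le_trans tbt.
  - exact: xb.
have phic : {within `[tb, +oo[, continuous (phi y)}.
  exact: (has_deriv_from_continuous phiC1.1).
split.
- by split.
- split => //; split => // t tbt.
  have [j _ mj] := glue_ge_from h4 m0 tbt.
  by rewrite (lt_le_trans ltr01)// (le_trans (m1 j)).
- by split => // t tbt; apply: dsub_lt; rewrite mulr_gt0.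
(* The inequality holds with the larger rate [dsub c]; it weakens to [dsub (2 * c)] since the form
   of [PR y t] is nonnegative. *)
- move=> t e q tbt Qq; apply: le_trans (ineq t e q tbt Qq) _.
  rewrite ler_wpM2r//.
    by apply: le_trans (Pge t tbt e); rewrite qform1 sqr_ge0.
  rewrite lerN2 /dsub lerD2l lerN2 ler_wpM2r ?expR_ge0//; lra.
split.
  have [[x xP] _] := Yy; have [dx yx xb] := trajP t0 y x t00 xP.
  have xc : {within `[tb, +oo[, continuous x}.
    exact: continuous_subspaceW sub_itv (has_deriv_from_continuous dx).
  have uP t : tb <= t -> PR y t \in unitmx.
    by move=> tbt; apply: mxform_ge1_unit; exact: Pge.
  (* Where [|x - z| <= xi] the clipping is the identity. The estimate shows that this holds at all
     times, so the clipped solution solves the observer itself. *)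
  have [z [z0 dz]] := clipped_observer_exists Fc Fl Hc tb0 (ltW xi0) Pc uP phic xc yc.
  have zc := has_deriv_from_continuous dz.
  have dz' t : tb <= t -> enorm (x t - z t) <= xi ->
      has_deriv_from tb z t (obs t (z t)).
    move=> tbt ext; have := dz t tbt.
    by rewrite (clip_enorm_id ext) opprB addrC subrK.
  have est := estimate x z xP zc z0 dz'.
  exists z; split; first exact: z0.
  move=> t tbt; apply: (dz' t tbt).
  exact: le_trans (ltW (est t tbt)) (bound_xi t tbt).
move=> x z xP [z0 dz].
have est := estimate x z xP (has_deriv_from_continuous dz) z0 (fun t tbt _ => dz t tbt).
split; last by move=> t tbt; rewrite integral_fromN//; exact: est.
(* The integral of [db] diverges to infinity, so the error bound tends to 0. *)
have small : B * Num.sqrt L * expR (- integral_from tb t (dsub (2 * c) y))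
    @[t --> +oo] --> 0.
  rewrite -[X in _ --> X](mulr0 (B * Num.sqrt L)); apply: cvgM; first exact: cvg_cst.
  exact: (cvg_comp _ _ Ioo (@cvgr_expR R)).
apply/cvgr0Pnorm_lt => e e0.
have tbe : \forall t \near +oo, tb <= t by apply: nbhs_pinfty_ge; exact: num_real.
near=> t.
apply: le_lt_trans (norm_le_enorm _) _.
have tbt : tb <= t by near: t; exact: tbe.
apply: lt_trans (est t tbt) _.
by near: t; apply: (cvgr_lt _ small).
Unshelve. all: by end_near. Qed.
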